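(* Let $F$ be a non-archimedean local field with odd residual characteristic, let $\mathbf{G}=\mathrm{GL}_2$ over $F$, let $\mathbf{H}$ be a maximal torus of $\mathbf{G}$ defined over $F$ which is not $F$-split, and write $G=\mathbf{G}(F)=\mathrm{GL}_2(F)$, $H=\mathbf{H}(F)$. Let $(\pi,V)$ be an irreducible $H$-distinguished representation of $G$. Then: (1) $(\pi,V)$ is $H$-relatively cuspidal if and only if it is supercuspidal. (2) $(\pi,V)$ is $H$-relatively square integrable if and only if it is square integrable. (3) $(\pi,V)$ is $H$-relatively tempered if and only if it is tempered.
   Context: All representations are admissible (in particular smooth) representations on complex vector spaces. $Z_G$ denotes the center of $G=\mathrm{GL}_2(F)$; note $Z_G\subseteq H$. Up to $G$-conjugacy, a maximal torus $\mathbf{H}$ that is not $F$-split is of the form $\left\{\begin{pmatrix} a & b\\ \tau b & a\end{pmatrix} : a^2-\tau b^2\neq 0\right\}$ with $\tau\in F^\times\smallsetminus (F^\times)^2$. An admissible representation $(\pi,V)$ of $G$ is $H$-distinguished if $\mathrm{Hom}_H(\pi,\mathbf{1})\neq 0$, i.e. there is a nonzero linear form $\lambda:V\to\mathbb{C}$ with $\lambda(\pi(h)v)=\lambda(v)$ for all $h\in H$, $v\in V$. (Since $Z_G\subseteq H$, an irreducible $H$-distinguished representation has trivial central character.) For $\lambda\in\mathrm{Hom}_H(\pi,\mathbf{1})$ and $v\in V$, the $H$-matrix coefficient $\varphi_{\lambda,v}:G/H\to\mathbb{C}$ is $\varphi_{\lambda,v}(g)=\langle\lambda,\pi(g^{-1})v\rangle$.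 An $H$-distinguished representation $(\pi,V)$ is: - $H$-relatively cuspidal if for all $v\in V$ and all $\lambda\in\mathrm{Hom}_H(\pi,\mathbf{1})$ the function $\varphi_{\lambda,v}$ is compactly supported modulo $Z_GH$; - (assuming unitary central character) $H$-relatively square integrable if for all $v\in V$ and all $\lambda\in\mathrm{Hom}_H(\pi,\mathbf{1})$ the function $\varphi_{\lambda,v}$ is square integrable modulo $Z_GH$, i.e. $|\varphi_{\lambda,v}|\in L^2(G/Z_GH)$ for a $G$-invariant measure on $G/Z_GH$; - (assuming unitary central character) $H$-relatively tempered if for all $\varepsilon>0$, all $v\in V$ and all $\lambda\in\mathrm{Hom}_H(\pi,\mathbf{1})$ one has $\varphi_{\lambda,v}\in L^{2+\varepsilon}(G/Z_GH)$. Supercuspidal, square integrable and tempered (without the prefix ''$H$-relatively'') have their usual meaning for irreducible admissible representations of $G$ in terms of ordinary matrix coefficients modulo $Z_G$: compactly supported modulo $Z_G$; unitary central character and square integrable modulo $Z_G$; unitary central character and in $L^{2+\varepsilon}(G/Z_G)$ for all $\varepsilon>0$, respectively. *)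

(* Defs.v *)
From HB Require Import structures.
From mathcomp Require Import all_boot all_order all_algebra.
From mathcomp Require Import all_classical all_reals all_analysis.
From mathcomp Require Import complex.
(* The notations of mpoly clash with those of mathcomp-analysis. *)
From mathcomp Require Import -(notations) mpoly.

Set Implicit Arguments.
Unset Strict Implicit.
Unset Printing Implicit Defensive.

Import Order.TTheory GRing.Theory Num.Theory.
Import ComplexField.

Local Open Scope classical_set_scope.
Local Open Scope ring_scope.
Local Open Scope complex_scope.
Local Open Scope quotient_scope.

HB.mixin Record Field_isNonarchValued (R : realType) F of GRing.Field F := {
  absv : F -> R;
  absv_ge0 : forall x, 0 <= absv x;
  absv_eq0 : forall x, (absv x == 0) = (x == 0);
  absvM : forall x y : F, absv (x * y) = absv x * absv y;
  absvD : forall x y : F, absv (x + y) <= Num.max (absv x) (absv y)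
}.

#[short(type="nonarchValuedFieldType")]
HB.structure Definition NonarchValuedField (R : realType) :=
  {F of Field_isNonarchValued R F & GRing.Field F}.

(* A copy of F carrying the metric |x - y|. *)
Definition absv_space (R : realType) (F : nonarchValuedFieldType R) : Type := F.

Section AbsvSpace.
Variables (R : realType) (F : nonarchValuedFieldType R).
Local Notation M := (absv_space F).

Let dist (x y : M) : R := absv ((x : F) - (y : F)).

Fact absvN1 : absv (-1 : F) = 1.
Proof.
have h1 : absv (1 : F) = 1.
  have n0 : absv (1 : F) != 0 by rewrite absv_eq0 oner_eq0.
  by apply: (mulfI n0); rewrite -absvM !mulr1.
apply/eqP; rewrite -(@eqrXn2 _ 2) ?absv_ge0 ?ler01//.
by rewrite expr1n expr2 -absvM mulrNN mulr1 h1.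
Qed.

Fact absv_dist0 (x : M) : dist x x = 0.
Proof. by apply/eqP; rewrite absv_eq0 subrr. Qed.
Fact absv_dist_eq (x y : M) : dist x y = 0 -> x = y.
Proof. by move/eqP; rewrite absv_eq0 subr_eq0 => /eqP. Qed.
Fact absv_dist_sym (x y : M) : dist x y = dist y x.
Proof. by rewrite /dist -opprB -mulN1r absvM absvN1 mul1r. Qed.
Fact absv_dist_triangle (y x z : M) : dist x z <= dist x y + dist y z.
Proof.
rewrite /dist -(subrKA (y : F)) (le_trans (absvD _ _))// ge_max.
by rewrite lerDl lerDr !absv_ge0.
Qed.

HB.instance Definition _ := Choice.on M.
HB.instance Definition _ :=
  isMetric.Build R M absv_dist0 absv_dist_eq absv_dist_sym absv_dist_triangle.

End AbsvSpace.

(* A non-archimedean local field: a field that is locally compact for a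
   nontrivial ultrametric absolute value.  The absolute value is determined
   only up to a positive power; no normalization is chosen. *)
HB.mixin Record NonarchValuedField_isLocal (R : realType) F
    of NonarchValuedField R F := {
  absv_nontrivial : exists x : F, 0 < absv x < 1;
  absv_locally_compact : locally_compact [set: absv_space F]
}.

#[short(type="nonarchLocalFieldType")]
HB.structure Definition NonarchLocalField (R : realType) :=
  {F of NonarchValuedField_isLocal R F & NonarchValuedField R F}.

(* The residue field is {absv <= 1} / {absv < 1}; its characteristic is the
   prime that is mapped into the maximal ideal. *)
Definition residue_char (R : realType) (F : nonarchLocalFieldType R) (p : nat) :=
  prime p /\ absv (p%:R : F) < 1.

Section GL2.
Variable F : fieldType.

Record GL2 := MkGL2 { GL2val :> 'M[F]_2; _ : GL2val \in unitmx }.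

HB.instance Definition _ := [isSub for GL2val].
HB.instance Definition _ := [Choice of GL2 by <:].

Lemma GL2_unit (g : GL2) : val g \in unitmx. Proof. exact: valP. Qed.

Definition GL2_one := MkGL2 (@unitmx1 F 2).

Definition GL2_inv (g : GL2) : GL2.
Proof. by exists (invmx (val g)); rewrite unitmx_inv GL2_unit. Defined.

Definition GL2_mul (g h : GL2) : GL2.
Proof. by exists (val g *m val h); rewrite unitmx_mul !GL2_unit. Defined.

Fact GL2_mulA : associative GL2_mul.
Proof. by move=> a b c; apply/val_inj; exact: mulmxA. Qed.
Fact GL2_mul1 : left_id GL2_one GL2_mul.
Proof. by move=> a; apply/val_inj; exact: mul1mx. Qed.
Fact GL2_mul1r : right_id GL2_one GL2_mul.
Proof. by move=> a; apply/val_inj; exact: mulmx1. Qed.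
Fact GL2_mulV : left_inverse GL2_one GL2_inv GL2_mul.
Proof. by move=> a; apply/val_inj; apply: mulVmx; exact: GL2_unit. Qed.
Fact GL2_mulVr : right_inverse GL2_one GL2_inv GL2_mul.
Proof. by move=> a; apply/val_inj; apply: mulmxV; exact: GL2_unit. Qed.

HB.instance Definition _ :=
  isGroup.Build GL2 GL2_mulA GL2_mul1 GL2_mul1r GL2_mulV GL2_mulVr.
HB.instance Definition _ := isPointed.Build GL2 GL2_one.

End GL2.

Definition GL2_map (F K : fieldType) (f : {rmorphism F -> K}) (g : GL2 F) : GL2 K.
Proof. by exists (map_mx f (val g)); rewrite map_unitmx GL2_unit. Defined.

(* Inversion being continuous on a local field, the subspace topology from
   the 2 x 2 matrices is the usual topology of GL_2(F). *)
Section GL2_topology.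
Variables (R : realType) (F : nonarchLocalFieldType R).
HB.instance Definition _ :=
  Topological.copy (GL2 F)
    (initial_topology (@GL2val F : GL2 F -> 'M[absv_space F]_2)).
End GL2_topology.

(** Linear algebraic subgroups of GL_2, in the language of varieties: K is an
    algebraically closed extension of F, an algebraic group is its group of
    K-points, and being defined over F is a condition on its ideal. *)
Section Tori.
Variable K : fieldType.
Implicit Types T : set (GL2 K).

Definition mx_eval (f : mpoly (2 * 2) K) (g : GL2 K) : K :=
  meval (fun i => mxvec (val g) 0 i) f.

Definition vanishing_ideal T : set (mpoly (2 * 2) K) :=
  [set f | forall g, T g -> mx_eval f g = 0].

Definition zariski_closed T :=
  exists I : set (mpoly (2 * 2) K),
    T = [set g | forall f, I f -> mx_eval f g = 0].

Definition zariski_connected T :=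
  forall A B, zariski_closed A -> zariski_closed B ->
    A `|` B = T -> A `&` B = set0 -> A = set0 \/ B = set0.

Definition is_subgroup T :=
  [/\ T 1%g, (forall g h, T g -> T h -> T (g * h)%g)
    & (forall g, T g -> T (g^-1)%g)].

Definition diagonalizable_group T :=
  exists P : GL2 K, forall g, T g -> is_diag_mx (val (P * g * P^-1)%g).

Definition torus T :=
  [/\ is_subgroup T, zariski_closed T, zariski_connected T
    & diagonalizable_group T].

Definition maximal_torus T :=
  torus T /\ forall T', torus T' -> T `<=` T' -> T' = T.

End Tori.

Section RationalStructure.
Variables (F K : fieldType) (iota : {rmorphism F -> K}) (T : set (GL2 K)).

(* The K-ideal of T is spanned by the polynomials over F that it contains. *)
Definition defined_over :=
  forall f, vanishing_ideal T f ->
    exists (n : nat) (c : 'I_n -> K) (q : 'I_n -> mpoly (2 * 2) F),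
      (forall i, vanishing_ideal T (map_mpoly iota (q i))) /\
      f = \sum_(i < n) c i *: map_mpoly iota (q i).

Definition split_over :=
  exists P : GL2 F, forall g, T g ->
    is_diag_mx (val (GL2_map iota P * g * (GL2_map iota P)^-1)%g).

Definition rational_points : set (GL2 F) := [set g | T (GL2_map iota g)].

End RationalStructure.

Definition group_center (G : groupType) : set G :=
  [set z | forall g, (z * g = g * z)%g].

Definition mulset (G : groupType) (A B : set G) : set G :=
  [set (a * b)%g | a in A & b in B].

(* G/S for a subgroup S: g and h are identified when g S = h S. *)
Section Cosets.
Variables (G : groupType) (S : set G).

Definition coset_eq (g h : G) : bool :=
  `[< mulset [set g] S = mulset [set h] S >].

Fact coset_eq_equiv : equiv_class_of coset_eq.
Proof.
split=> [g|g h|h g k]; rewrite /coset_eq.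
- exact/asboolP.
- by apply/asboolP/asboolP => ->.
- by move=> /asboolP e1 /asboolP e2; apply/asboolP; rewrite e1.
Qed.
Canonical coset_equiv := EquivRelPack coset_eq_equiv.

End Cosets.

Section Main.
Variables (R : realType) (F : nonarchLocalFieldType R).
Local Notation C := R[i].
Local Notation G := (GL2 F).

(* G/S with the quotient topology and its Borel sigma-algebra. *)
Section CosetSpace.
Variable S : set G.

Definition coset_space : ptopologicalType :=
  quotient_topology {eq_quot coset_equiv S}.

Definition coset_proj (g : G) : coset_space :=
  \pi_{eq_quot coset_equiv S} g.

Definition coset_repr (q : coset_space) : G :=
  repr (q : {eq_quot coset_equiv S}).

Definition coset_borel := g_sigma_algebraType (@open coset_space).

Definition coset_act (g : G) (q : coset_space) : coset_space :=
  coset_proj (g * coset_repr q)%g.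

(* A nonzero G-invariant Radon measure on G/S (G being second countable,
   Borel measures finite on compact sets are regular). *)
Definition invariant_measure (mu : {measure set coset_borel -> \bar R}) : Prop :=
  [/\ mu [set: coset_borel] != 0%E,
      (forall A : set coset_space, compact A -> (mu A < +oo)%E)
    & (forall (g : G) (A : set coset_borel), measurable A ->
         mu (coset_act g @^-1` A) = mu A)].

Definition compact_mod (f : G -> C) :=
  compact (coset_proj @` closure [set g | f g != 0]).

(* |f|, as a function on G/S; meaningful when |f| is right S-invariant. *)
Definition coset_abs (f : G -> C) (q : coset_borel) : R :=
  Normc.normc (f (coset_repr q)).

Definition Lp_mod (mu : {measure set coset_borel -> \bar R}) (p : R)
    (f : G -> C) : Prop :=
  coset_abs f \in Lfun mu p%:E.

End CosetSpace.

Record representation (V : lmodType C) := Representation {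
  rep_fun :> G -> {linear V -> V};
  rep1 : forall v, rep_fun 1%g v = v;
  repM : forall g h v, rep_fun (g * h)%g v = rep_fun g (rep_fun h v)
}.

Section Representations.
Variables (V : lmodType C) (pi : representation V).
Implicit Types (W : set V) (H : set G) (lam : {scalar V}).

Definition linear_subspace W :=
  W 0 /\ forall (a : C) u v, W u -> W v -> W (a *: u + v).

Definition finite_dim W :=
  exists (n : nat) (e : 'I_n -> V), (forall i, W (e i)) /\
    forall v, W v -> exists c : 'I_n -> C, v = \sum_(i < n) c i *: e i.

Definition invariants H : set V := [set v | forall h, H h -> pi h v = v].

Definition smooth := forall v, open [set g | pi g v = v].

Definition admissible :=
  smooth /\ forall H, is_subgroup H -> open H -> compact H ->
    finite_dim (invariants H).

Definition irreducible :=
  (exists v : V, v != 0) /\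
  forall W, linear_subspace W -> (forall g v, W v -> W (pi g v)) ->
    W = [set 0] \/ W = setT.

Definition unitary_central_character :=
  exists chi : G -> C, forall z, group_center z ->
    `|chi z| = 1 /\ forall v, pi z v = chi z *: v.

Definition smooth_dual : set {scalar V} :=
  [set lam | open [set g | forall v, lam (pi g v) = lam v]].

Definition matrix_coef lam (v : V) (g : G) : C := lam (pi g v).

Definition supercuspidal :=
  forall lam v, smooth_dual lam -> compact_mod (@group_center G) (matrix_coef lam v).

Definition square_integrable
    (mu : {measure set (coset_borel (@group_center G)) -> \bar R}) :=
  unitary_central_character /\
  forall lam v, smooth_dual lam -> Lp_mod mu 2 (matrix_coef lam v).

Definition tempered
    (mu : {measure set (coset_borel (@group_center G)) -> \bar R}) :=
  unitary_central_character /\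
  forall e : R, 0 < e -> forall lam v, smooth_dual lam ->
    Lp_mod mu (2 + e) (matrix_coef lam v).

Section Relative.
Variable H : set G.

Definition Hom_to_trivial : set {scalar V} :=
  [set lam | forall h v, H h -> lam (pi h v) = lam v].

Definition distinguished :=
  exists2 lam, Hom_to_trivial lam & exists v, lam v != 0.

Definition rel_matrix_coef lam (v : V) (g : G) : C := lam (pi (g^-1)%g v).

Definition ZH := mulset (@group_center G) H.

Definition rel_cuspidal :=
  forall v lam, Hom_to_trivial lam -> compact_mod ZH (rel_matrix_coef lam v).

Definition rel_square_integrable
    (nu : {measure set (coset_borel ZH) -> \bar R}) :=
  unitary_central_character /\
  forall v lam, Hom_to_trivial lam -> Lp_mod nu 2 (rel_matrix_coef lam v).

Definition rel_tempered (nu : {measure set (coset_borel ZH) -> \bar R}) :=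
  unitary_central_character /\
  forall e : R, 0 < e -> forall v lam, Hom_to_trivial lam ->
    Lp_mod nu (2 + e) (rel_matrix_coef lam v).

End Relative.
End Representations.
End Main.

(* Main.v *)
Require Import Defs.
From HB Require Import structures.
From mathcomp Require Import all_boot all_order all_algebra.
From mathcomp Require Import all_classical all_reals all_analysis.
From mathcomp Require Import measurable_realfun.
From mathcomp Require Import complex.
From mathcomp Require Import -(notations) mpoly.
From mathcomp Require Import ring lra.
From mathcomp Require finmap.

Set Implicit Arguments.
Unset Strict Implicit.
Unset Printing Implicit Defensive.

Import Order.TTheory GRing.Theory Num.Theory.
Local Open Scope classical_set_scope.
Local Open Scope ring_scope.
Local Open Scope complex_scope.

(** Write G = GL_2(F), Z for its center and H for the group of rational points
    of the torus.  H consists of the nonzero elements of a quadratic field E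
    that is contained in the 2 x 2 matrices ([nonsplit_torusP]).  As F^2 is a
    line over E, the group H acts transitively on nonzero vectors, and it is
    compact modulo Z.

    The idea is that every H-invariant form lam on pi is smooth
    ([Hom_etorus_smooth]), so that the relative matrix coefficients are
    ordinary matrix coefficients composed with inversion.  Fix a nonzero v that
    is fixed by a neighbourhood U of 1, and an element x of G.  If g is close
    to 1, it moves the largest column of x very little, so some h in H close
    to 1 moves this column back.  Then h g is close to 1 and fixes the
    direction in which x is largest, which keeps x^-1 (h g) x in U, no matter
    how large x is ([etorus_correction]).  Hence
      lam (pi (g x) v) = lam (pi (h g x) v) = lam (pi x v)
    for all x, and the translates of v span the representation.

    It remains to compare functions on G/Z with functions on G/H, and a single
    form with all forms.

    - For a locally constant function, compact support modulo Z or modulo H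
      means that the support is bounded modulo Z ([compact_modP]), and this
      condition is stable under inversion.

    - A relative coefficient is right invariant under an open subgroup P that
      contains H and is compact modulo Z.  Its integrals over G/Z and over G/H
      are sums over the countable set G/P whose terms differ by a constant
      factor ([Lp_mod_change]).  Inversion does not affect integrability over
      G/Z, because G is unimodular ([unimodular], [Lp_mod_inv]): every x is
      conjugate modulo Z to its inverse, so the modular character, which has
      positive values, is trivial.

    - By irreducibility and admissibility, every smooth form is a finite
      combination of translates of one nonzero H-invariant form
      ([smooth_dual_span]), and the decay conditions are stable under
      translations and finite combinations ([Lp_mod_combination]). *)

(** * Valued fields and 2 x 2 matrices *)

Section ValuedField.
Variables (R : realType) (F : nonarchLocalFieldType R).
Implicit Types x y a : F.

Lemma absv1 : absv (1 : F) = 1.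
Proof.
have n0 : absv (1 : F) != 0 by rewrite absv_eq0 oner_eq0.
by apply: (mulfI n0); rewrite -absvM !mulr1.
Qed.

Lemma absvN x : absv (- x) = absv x.
Proof. by rewrite -mulN1r absvM absvN1 mul1r. Qed.

Lemma absv0 : absv (0 : F) = 0.
Proof. by apply/eqP; rewrite absv_eq0. Qed.

Lemma absv_gt0 x : (0 < absv x) = (x != 0).
Proof. by rewrite lt_def absv_eq0 absv_ge0 andbT. Qed.

Lemma absvV x : absv x^-1 = (absv x)^-1.
Proof.
have [->|x0] := eqVneq x 0; first by rewrite invr0 absv0 invr0.
have ax : absv x != 0 by rewrite absv_eq0.
by apply: (mulfI ax); rewrite -absvM !divff// absv1.
Qed.

Lemma absvX x n : absv (x ^+ n) = absv x ^+ n.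
Proof. by elim: n => [|n IH]; rewrite ?expr0 ?absv1// !exprS absvM IH. Qed.

Lemma absvD_le (r : R) x y : absv x <= r -> absv y <= r -> absv (x + y) <= r.
Proof. by move=> xr yr; rewrite (le_trans (absvD _ _))// ge_max xr yr. Qed.

Lemma absvB_le (r : R) x y : absv x <= r -> absv y <= r -> absv (x - y) <= r.
Proof. by move=> xr yr; rewrite absvD_le// absvN. Qed.

Lemma absvD_lt (r : R) x y : absv x < r -> absv y < r -> absv (x + y) < r.
Proof. by move=> xr yr; rewrite (le_lt_trans (absvD _ _))// gt_max xr yr. Qed.

Lemma absvM_le (r s : R) x y :
  absv x <= r -> absv y <= s -> absv (x * y) <= r * s.
Proof. by move=> xr ys; rewrite absvM ler_pM ?absv_ge0. Qed.

(** The ultrametric inequality makes the absolute value locally constant away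
    from 0. *)
Lemma absv_near x y : absv (x - y) < absv x -> absv y = absv x.
Proof.
move=> xy; apply/eqP; rewrite eq_le; apply/andP; split.
  by rewrite -[y](subKr x) absvB_le// ltW.
rewrite leNgt; apply/negP => yx.
by have := absvD_lt xy yx; rewrite subrK ltxx.
Qed.

Lemma absv_near1 y : absv (y - 1) < 1 -> absv y = 1.
Proof.
by move=> y1; rewrite (@absv_near 1 y) ?absv1// -opprB absvN.
Qed.

Lemma absv_space_ballE (x : absv_space F) (e : R) :
  ball x e = [set y : absv_space F | absv ((x : F) - y) < e].
Proof. by rewrite ballEmdist. Qed.

Lemma absv_spaceP (x : absv_space F) (A : set (absv_space F)) :
  nbhs x A <->
  exists2 e : R, 0 < e & forall y : F, absv (y - x) < e -> A y.
Proof.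
split=> [/nbhs_ballP[e /= e0 eA]|[e e0 eA]].
  exists e => // y xy; apply: eA; rewrite absv_space_ballE/=.
  by rewrite -absvN opprB.
apply/nbhs_ballP; exists e => //= y; rewrite absv_space_ballE/= => xy.
by apply: eA; rewrite -absvN opprB.
Qed.

(** Scaling carries the compact neighbourhood of 0 given by local compactness
    onto a set that contains the ball, which is closed. *)
Lemma compact_absv_ball (r : R) :
  compact [set x : absv_space F | absv (x : F) <= r].
Proof.
have [r0|r0] := ltP r 0.
  rewrite [X in compact X](_ : _ = set0); first exact: compact0.
  apply/seteqP; split=> // x /= xr; have := le_lt_trans xr r0.
  by rewrite ltNge absv_ge0.
have [U nU [cU _]] := @absv_locally_compact R F (0 : absv_space F) I.
have {nU} /absv_spaceP[e e0 eU] : nbhs (0 : absv_space F) U.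
  by move: nU; rewrite /= /within/=; apply: filterS => x; apply.
have [c /andP[c0 c1]] := @absv_nontrivial R F.
have [n nr] : exists n, absv c ^+ n * r < e.
  have ac : `|absv c| < 1 by rewrite ger0_norm// ltW.
  have /cvgr_lt /(_ _ e0) [n _ h] := cvg_geometric r ac.
  by exists n; rewrite mulrC; exact: (h n (leqnn n)).
pose f (x : absv_space F) : absv_space F := (c ^+ n * (x : F)).
pose g (x : absv_space F) : absv_space F := (c ^- n * (x : F)).
have cn0 : c ^+ n != 0 by rewrite expf_neq0// -absv_gt0.
have gc : continuous g.
  move=> x A /absv_spaceP[d d0 dA]; apply/absv_spaceP.
  exists (d * absv (c ^+ n)); first by rewrite mulr_gt0// absv_gt0.
  move=> y xy; apply: dA; rewrite /g -mulrBr absvM absvV mulrC.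
  by rewrite ltr_pdivrMr// absv_gt0.
have cgU : compact (g @` U).
  by apply: continuous_compact cU; exact: continuous_subspaceT.
apply: subclosed_compact cgU _.
  rewrite -[X in closed X]setCK; apply: open_closedC.
  rewrite openE => x /= /negP; rewrite -ltNge => rx; apply/absv_spaceP.
  exists (absv (x : F)); first exact: le_lt_trans rx.
  by move=> y xy; apply/negP; rewrite -ltNge (@absv_near x)// -absvN opprB.
move=> x /= xr; exists (f x); last by rewrite /g /f mulKf.
apply: eU; rewrite subr0 absvM absvX (le_lt_trans _ nr)// ler_wpM2l//.
by rewrite exprn_ge0// ltW.
Qed.

End ValuedField.

Section Entries.
Variable F : fieldType.
Implicit Types g h : GL2 F.

Lemma sum_ord2 (V : zmodType) (f : 'I_2 -> V) : \sum_i f i = f 0 + f 1.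
Proof.
by rewrite big_ord_recl big_ord1; congr (f _ + f _); apply: val_inj.
Qed.

Lemma ord2P (i : 'I_2) : {i = 0} + {i = 1}.
Proof. by case: i => [[|[|//]]] ?; [left|right]; apply: val_inj. Qed.

Lemma forall_ord2 (P : 'I_2 -> Prop) : P 0 -> P 1 -> forall i, P i.
Proof. by move=> P0 P1 i; case: (ord2P i) => ->. Qed.

Definition mx22 (a b c d : F) : 'M[F]_2 :=
  \matrix_(i, j) if i == 0 then (if j == 0 then a else b)
                 else (if j == 0 then c else d).

Lemma mx22E a b c d : [/\ mx22 a b c d 0 0 = a, mx22 a b c d 0 1 = b,
  mx22 a b c d 1 0 = c & mx22 a b c d 1 1 = d].
Proof. by rewrite !mxE. Qed.

Lemma mxDE (A B : 'M[F]_2) i j : (A + B) i j = A i j + B i j.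
Proof. by rewrite mxE. Qed.

Lemma mxNE (A : 'M[F]_2) i j : (- A) i j = - A i j.
Proof. by rewrite mxE. Qed.

Lemma mxZE a (A : 'M[F]_2) i j : (a *: A) i j = a * A i j.
Proof. by rewrite mxE. Qed.

Lemma mulmx22 (A B : 'M[F]_2) i j :
  (A *m B) i j = A i 0 * B 0 j + A i 1 * B 1 j.
Proof. by rewrite mxE sum_ord2. Qed.

Lemma det22 (A : 'M[F]_2) : \det A = A 0 0 * A 1 1 - A 0 1 * A 1 0.
Proof.
rewrite (expand_det_row _ 0) sum_ord2 /cofactor !det_mx11 !mxE/=.
rewrite addn0 expr0 mul1r expr1 mulN1r mulrN.
by congr (_ * A _ _ - _ * A _ _); apply: val_inj.
Qed.

Lemma eq_mx22 (A B : 'M[F]_2) : A 0 0 = B 0 0 -> A 0 1 = B 0 1 ->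
  A 1 0 = B 1 0 -> A 1 1 = B 1 1 -> A = B.
Proof.
by move=> *; apply/matrixP; apply: forall_ord2; apply: forall_ord2.
Qed.

(** Total version of the constructor, with value 1 on singular matrices. *)
Definition GL2_of (A : 'M[F]_2) : GL2 F := insubd (1%g : GL2 F) A.

Lemma GL2_ofE (A : 'M[F]_2) : \det A != 0 -> GL2_of A = A :> 'M[F]_2.
Proof.
move=> A0; have uA : A \in unitmx by rewrite unitmxE unitfE.
exact: (insubdK (1%g : GL2 F) uA).
Qed.

Lemma GL2_det g : \det g != 0.
Proof. by have := GL2_unit g; rewrite unitmxE unitfE. Qed.

Lemma GL2_eq g h : g = h :> 'M[F]_2 -> g = h.
Proof. exact: val_inj. Qed.

Lemma GL2_valM g h : (g * h)%g = g *m h :> 'M[F]_2.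
Proof. by []. Qed.

Lemma GL2_val1 : (1 : GL2 F)%g = 1%:M :> 'M[F]_2.
Proof. by []. Qed.

Lemma GL2_detM g h : \det (g * h)%g = \det g * \det h.
Proof. by rewrite GL2_valM det_mulmx. Qed.

Lemma GL2_mul_entry g h i j : (g * h)%g i j = g i 0 * h 0 j + g i 1 * h 1 j.
Proof. by rewrite GL2_valM mulmx22. Qed.

Lemma GL2_inv_entries g : [/\ (g^-1)%g 0 0 = g 1 1 / \det g,
  (g^-1)%g 0 1 = - g 0 1 / \det g, (g^-1)%g 1 0 = - g 1 0 / \det g &
  (g^-1)%g 1 1 = g 0 0 / \det g].
Proof.
pose A := mx22 (g 1 1 / \det g) (- g 0 1 / \det g) (- g 1 0 / \det g)
  (g 0 0 / \det g).
have d0 := GL2_det g.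
suff -> : (g^-1)%g = A :> 'M[F]_2 by exact: mx22E.
have gA : g *m A = 1%:M.
  rewrite det22 in d0.
  by apply: eq_mx22; rewrite mulmx22 !mxE/= det22; field.
by rewrite -[RHS]mul1mx -[1%:M]/((1 : GL2 F)%g : 'M[F]_2) -(mulVg g) GL2_valM
  -mulmxA gA mulmx1.
Qed.

Lemma GL2_detV g : \det (g^-1)%g = (\det g)^-1.
Proof.
apply: (mulfI (GL2_det g)).
by rewrite divff ?GL2_det// -GL2_detM mulgV GL2_val1 det1.
Qed.

Lemma GL2_centerP (z : GL2 F) : group_center z <->
  [/\ z 0 1 = 0, z 1 0 = 0 & z 0 0 = z 1 1].
Proof.
split=> [zC|[z01 z10 z11] g]; last first.
  apply: GL2_eq; apply: eq_mx22; rewrite !GL2_mul_entry ?z01 ?z10 ?z11; ring.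
have d1 : \det (mx22 1 1 0 1) != 0.
  by rewrite det22 !mxE/= mulr1 mulr0 subr0 oner_neq0.
have d2 : \det (mx22 1 0 1 1) != 0.
  by rewrite det22 !mxE/= mulr1 mul0r subr0 oner_neq0.
have e1 i j : (z * GL2_of (mx22 1 1 0 1))%g i j = (GL2_of (mx22 1 1 0 1) * z)%g i j.
  by rewrite zC.
have e2 i j : (z * GL2_of (mx22 1 0 1 1))%g i j = (GL2_of (mx22 1 0 1 1) * z)%g i j.
  by rewrite zC.
have := e1 0 1; have := e1 0 0; have := e2 0 0.
rewrite !GL2_mul_entry !GL2_ofE// !mxE/= !(mulr0, mulr1, mul1r, mul0r, addr0, add0r).
move=> /eqP; rewrite addrC -subr_eq0 addrK => /eqP z01 /eqP.
rewrite -subr_eq0 opprD addrA subrr sub0r oppr_eq0 => /eqP z10.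
by move=> /addrI.
Qed.

Definition scalar_GL2 (a : F) : GL2 F := GL2_of (a%:M).

Lemma scalar_GL2E a : a != 0 -> scalar_GL2 a = a%:M :> 'M[F]_2.
Proof. by move=> a0; rewrite GL2_ofE// det_scalar expf_neq0. Qed.

Lemma scalar_GL2_center a : a != 0 -> group_center (scalar_GL2 a).
Proof. by move=> a0; apply/GL2_centerP; rewrite scalar_GL2E// !mxE. Qed.

Lemma scalar_GL2M a g i j : a != 0 -> (scalar_GL2 a * g)%g i j = a * g i j.
Proof. by move=> a0; rewrite GL2_valM scalar_GL2E// mul_scalar_mx mxE. Qed.

Lemma scalar_GL2_det a g : a != 0 ->
  \det (scalar_GL2 a * g)%g = a ^+ 2 * \det g.
Proof. by move=> a0; rewrite GL2_detM scalar_GL2E// det_scalar. Qed.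

End Entries.

(** The nonzero elements u + v X of the algebra F[X] generated by the companion
    matrix X of T^2 - t T - n, described by their first column (u, v).  Every
    nonsplit torus has this form, and the norm form [tnorm] is the
    determinant. *)
Section EllipticTorusDef.
Variables (F : fieldType) (n t : F).
Implicit Types (g h : GL2 F) (u v : F).

Definition tnorm u v := u ^+ 2 + t * u * v - n * v ^+ 2.

Definition tmx u v := mx22 u (n * v) v (u + t * v).

Definition etorus : set (GL2 F) :=
  [set g : GL2 F | g 0 1 = n * g 1 0 /\ g 1 1 = g 0 0 + t * g 1 0].

Lemma det_tmx u v : \det (tmx u v) = tnorm u v.
Proof. by rewrite det22 !mxE/= /tnorm; ring. Qed.

Lemma etorusE g : etorus g -> g = tmx (g 0 0) (g 1 0) :> 'M[F]_2.
Proof. by move=> [g01 g11]; apply: eq_mx22; rewrite !mxE. Qed.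

Lemma etorus_tmx u v : tnorm u v != 0 -> etorus (GL2_of (tmx u v)).
Proof. by move=> uv0; rewrite /etorus/= GL2_ofE ?det_tmx// !mxE. Qed.

Lemma etorus_subgroup : is_subgroup etorus.
Proof.
split.
- by split; rewrite GL2_val1 !mxE/= mulr0 ?addr0.
- by move=> g h [g01 g11] [h01 h11]; split; rewrite !GL2_mul_entry ?g01 ?g11 ?h01 ?h11; ring.
- move=> g [g01 g11]; have [v00 v01 v10 v11] := GL2_inv_entries g.
  by split; rewrite ?v00 ?v01 ?v10 ?v11 ?g01 ?g11; ring.
Qed.

Lemma center_etorus : @group_center (GL2 F) `<=` etorus.
Proof.
by move=> z /GL2_centerP[z01 z10 z00]; split; rewrite ?z01 ?z10 ?z00 mulr0 ?addr0.
Qed.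

End EllipticTorusDef.

(** * Rational points of a nonsplit maximal torus *)
Section PolynomialLines.
Variable K : fieldType.

Lemma horner_mmap k (h : 'I_k -> {poly K}) (f : mpoly k K) (u : K) :
  (mmap polyC h f).[u] = meval (fun i => (h i).[u]) f.
Proof.
rewrite /meval /mmap horner_sum; apply: eq_bigr => m _.
rewrite hornerM hornerC /mmap1 horner_prod; congr (_ * _).
by apply: eq_bigr => i _; rewrite horner_exp.
Qed.

Lemma meval_ext k (v w : 'I_k -> K) (f : mpoly k K) : v =1 w -> meval v f = meval w f.
Proof. by move=> vw; congr (meval _ f); apply/funext. Qed.

Definition linear_part k (f : mpoly k K) : 'rV[K]_k := \row_i mcoeff (mnm1 i) f.

(** Restricting to the line through the origin and x turns linear parts into
    coefficients of a polynomial in one variable. *)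
Lemma coef1_mmap_line k (x : 'I_k -> K) (f : mpoly k K) :
  (mmap polyC (fun i => x i *: 'X) f)`_1 = \sum_i linear_part f 0 i * x i.
Proof.
rewrite /mmap coef_sum.
have mE m : ((mcoeff m f)%:P * mmap1 (fun i => x i *: 'X) m)`_1 =
    \sum_i (if m == mnm1 i then mcoeff m f * x i else 0).
  rewrite coefCM.
  have -> : mmap1 (fun i => x i *: 'X) m =
      (\prod_i x i ^+ m i) *: 'X^(mdeg m) :> {poly K}.
    rewrite /mmap1 mdegE -mul_polyC rmorph_prod/= -prodrXr -big_split/=.
    by apply: eq_bigr => i _; rewrite -mul_polyC exprMn rmorphXn.
  rewrite coefZ coefXn eq_sym; case: mdeg1P => [[i /eqP ->]|m1].
    rewrite [RHS](bigD1 i)//= eqxx [X in _ + X]big1 ?addr0 => [|j /negPf ji]; last first.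
      by rewrite eq_mnm1 eq_sym ji.
    rewrite mulr1; congr (_ * _); rewrite (bigD1 i)//= mnm1E eqxx expr1.
    by rewrite big1 ?mulr1// => j /negPf ji; rewrite mnm1E eq_sym ji expr0.
  rewrite !mulr0 big1// => i _; case: eqP => // mi.
  by case: m1; exists i; rewrite mi.
under eq_bigr do rewrite mE.
rewrite exchange_big/=; apply: eq_bigr => i _; rewrite mxE.
have [Ui|Ui] := boolP (mnm1 i \in msupp f).
  rewrite (bigD1_seq (mnm1 i))//= eqxx big1_seq ?addr0// => m /andP[/negPf mi _].
  by rewrite mi.
rewrite (memN_msupp_eq0 Ui) mul0r big1_seq// => m /andP[_ mf].
by case: eqP => // mi; rewrite mi (negPf Ui) in mf.
Qed.

Definition linear_form k (c : 'rV[K]_k) : mpoly k K :=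
  \sum_i c 0 i *: mpolyX K (mnm1 i).

Lemma meval_linear_form k (c : 'rV[K]_k) x :
  meval x (linear_form c) = \sum_i c 0 i * x i.
Proof.
rewrite /linear_form raddf_sum; apply: eq_bigr => i _.
by rewrite /= mevalZ mevalXU.
Qed.

Lemma linear_part_linear_form k (c : 'rV[K]_k) : linear_part (linear_form c) = c.
Proof.
apply/rowP => j; rewrite mxE /linear_form raddf_sum/= (bigD1 j)//= mcoeffZ mcoeffXU.
rewrite eqxx mulr1 big1 ?addr0// => i /negPf ij.
by rewrite mcoeffZ mcoeffXU ij mulr0.
Qed.

End PolynomialLines.

Section SplitTorus.
Variable K : closedFieldType.
Implicit Types (P g : GL2 K) (x : 'M[K]_2).

Definition conj22 P x : 'M[K]_2 := P *m x *m invmx P.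

Lemma conj22D P x y : conj22 P (x + y) = conj22 P x + conj22 P y.
Proof. by rewrite /conj22 mulmxDr mulmxDl. Qed.

Lemma conj22Z P a x : conj22 P (a *: x) = a *: conj22 P x.
Proof. by rewrite /conj22 -scalemxAr -scalemxAl. Qed.

Lemma conj22_scalar P a : conj22 P a%:M = a%:M.
Proof.
by rewrite /conj22 mul_mx_scalar -scalemxAl mulmxV ?GL2_unit// scalemx1.
Qed.

Lemma conj22_inj P : injective (conj22 P).
Proof.
move=> x y /(congr1 (fun z => invmx P *m z *m P)); rewrite /conj22.
by rewrite !mulmxA mulVmx ?GL2_unit// !mul1mx -!mulmxA mulVmx ?GL2_unit// !mulmx1.
Qed.

Lemma conj22K P x : conj22 P (invmx P *m x *m P) = x.
Proof.
rewrite /conj22 !mulmxA mulmxV ?GL2_unit// mul1mx -mulmxA mulmxV ?GL2_unit//.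
by rewrite mulmx1.
Qed.

Lemma diag22P (x : 'M[K]_2) : is_diag_mx x <-> x 0 1 = 0 /\ x 1 0 = 0.
Proof.
split=> [/is_diag_mxP xd|[x01 x10]]; first by split; exact: xd.
by apply/is_diag_mxP; do 2 apply: forall_ord2.
Qed.

Definition diag_torus P : set (GL2 K) := [set g | is_diag_mx (conj22 P g)].

(** The coordinates of [conj22 P x] are linear forms in the coordinates of x;
    this is the coefficient vector of one of them. *)
Definition conj_coord P (k : 'I_(2 * 2)) : 'rV[K]_(2 * 2) :=
  (col k (lin_mx (mulmxr (invmx P) \o mulmx P)))^T.

Lemma conj_coordE P i j x : conj22 P x i j =
  \sum_k conj_coord P (mxvec_index i j) 0 k * mxvec x 0 k.
Proof.
rewrite -mxvecE /conj22 -[_ *m invmx P]/((mulmxr (invmx P) \o mulmx P) x).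
rewrite -mul_vec_lin mxE; apply: eq_bigr => k _.
by rewrite mulrC !mxE.
Qed.

Lemma diag_torus_closed P : zariski_closed (diag_torus P).
Proof.
exists [set linear_form (conj_coord P (mxvec_index 0 1));
        linear_form (conj_coord P (mxvec_index 1 0))].
apply/seteqP; split=> g /=.
  by move=> /diag22P[g01 g10] f [->|->]; rewrite /mx_eval meval_linear_form -conj_coordE.
move=> H; apply/diag22P; split; rewrite conj_coordE -meval_linear_form; apply: H;
  by [left|right].
Qed.

Lemma diag_torusE P g : diag_torus P g <->
  (P * g * P^-1)%g 0 1 = 0 /\ (P * g * P^-1)%g 1 0 = 0.
Proof. exact: diag22P. Qed.

Lemma diag_torus_subgroup P : is_subgroup (diag_torus P).
Proof.
split=> [|g h|g].
- by apply/diag_torusE; rewrite mulg1 mulgV !mxE.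
- move=> /diag_torusE[g01 g10] /diag_torusE[h01 h10]; apply/diag_torusE.
  have -> : (P * (g * h) * P^-1 = (P * g * P^-1) * (P * h * P^-1))%g.
    by rewrite !mulgA mulgVK.
  by rewrite !(GL2_mul_entry (P * g * P^-1)%g) g01 g10 h01 h10 !mul0r !mulr0 addr0.
- move=> /diag_torusE[g01 g10]; apply/diag_torusE.
  have -> : (P * g^-1 * P^-1 = (P * g * P^-1)^-1)%g.
    by rewrite !invgM invgK mulgA.
  by have [_ -> -> _] := GL2_inv_entries (P * g * P^-1)%g; rewrite g01 g10 oppr0 !mul0r.
Qed.

(** Two points of the torus lie on a line of matrices, all of whose invertible
    members are in the torus, and a line is irreducible. *)
Lemma diag_torus_connected P : zariski_connected (diag_torus P).
Proof.
move=> A B [I AE] [J BE] AB AB0; apply: contrapT => /not_orP[/eqP/set0P[a Aa]].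
move=> /eqP/set0P[b Bb].
have [f Jf fa] : exists2 f, J f & mx_eval f a != 0.
  apply: contrapT => H; have : (A `&` B) a; last by rewrite AB0.
  split=> //; rewrite BE => f Jf; apply/eqP; apply: contrapT => /negP fa.
  by apply: H; exists f.
have [f' If fb] : exists2 f, I f & mx_eval f b != 0.
  apply: contrapT => H; have : (A `&` B) b; last by rewrite AB0.
  split=> //; rewrite AE => f' If; apply/eqP; apply: contrapT => /negP fb.
  by apply: H; exists f'.
have Da : is_diag_mx (conj22 P a) by have : diag_torus P a by rewrite -AB; left.
have Db : is_diag_mx (conj22 P b) by have : diag_torus P b by rewrite -AB; right.
pose L (u : K) : 'M[K]_2 := GL2val a + u *: (GL2val b - GL2val a).
pose M i : {poly K} := (mxvec a 0 i)%:P + (mxvec b 0 i - mxvec a 0 i) *: 'X.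
have ME u i : (M i).[u] = mxvec (L u) 0 i.
  rewrite !hornerE; case/mxvec_indexP: i => i j.
  by rewrite !mxvecE !mxE mulrC.
pose pf := mmap polyC M f; pose pf' := mmap polyC M f'.
have pE q u : (mmap polyC M q).[u] = meval (mxvec (L u) 0) q.
  by rewrite horner_mmap; apply: meval_ext => i; rewrite ME.
have L0 : L 0 = a by rewrite /L scale0r addr0.
have L1 : L 1 = b by rewrite /L scale1r addrC subrK.
pose Mi i j := M (mxvec_index i j).
pose pd := Mi 0 0 * Mi 1 1 - Mi 0 1 * Mi 1 0.
have pdE u : pd.[u] = \det (L u).
  by rewrite det22 /pd hornerD hornerN !hornerM /Mi !ME !mxvecE.
have pf0 : pf != 0.
  have fE : mx_eval f a = pf.[0] by rewrite pE L0.
  by apply: contraNneq fa => z; rewrite fE z horner0.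
have pf'0 : pf' != 0.
  have fE : mx_eval f' b = pf'.[1] by rewrite pE L1.
  by apply: contraNneq fb => z; rewrite fE z horner0.
have pd0 : pd != 0.
  by apply: contraNneq (GL2_det a) => z; rewrite -L0 -pdE z horner0.
(* A point of the line that avoids A, B and the singular matrices. *)
have /closed_nonrootP[u] : pf * pf' * pd != 0 by rewrite !mulf_neq0.
rewrite /root !hornerM !mulf_eq0 !negb_or => /andP[/andP[fu f'u]].
rewrite pdE => du; have gE := GL2_ofE du.
have : diag_torus P (GL2_of (L u)).
  move: Da Db => /diag22P[a01 a10] /diag22P[b01 b10].
  apply/diag22P; rewrite gE /L conj22D conj22Z conj22D -[- GL2val a]scaleN1r.
  by rewrite conj22Z !(mxDE, mxZE) a01 a10 b01 b10 !(mulr0, addr0).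
rewrite -AB => -[]; rewrite ?AE ?BE.
  move=> /(_ f' If) /eqP; have -> : mx_eval f' (GL2_of (L u)) = pf'.[u].
    by rewrite pE -[in RHS]gE.
  by rewrite (negPf f'u).
move=> /(_ f Jf) /eqP; have -> : mx_eval f (GL2_of (L u)) = pf.[u].
  by rewrite pE -[in RHS]gE.
by rewrite (negPf fu).
Qed.

(** A torus is contained in some [diag_torus P], which is itself a torus. *)
Lemma maximal_torusP (T : set (GL2 K)) : maximal_torus T ->
  exists P, T = diag_torus P.
Proof.
move=> [[_ _ _ [P TP]] Tmax]; exists P; apply/esym/Tmax => //.
split; [exact: diag_torus_subgroup | exact: diag_torus_closed |
  exact: diag_torus_connected | by exists P].
Qed.

Lemma det_conj22 P x : \det (conj22 P x) = \det x.
Proof.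
by rewrite /conj22 !det_mulmx mulrC det_inv mulrA mulVf ?mul1r// GL2_det.
Qed.

(** The torus is stable under nonzero scalars, so the linear part of f vanishes
    on it, and it spans the algebra of all x that P conjugates to a diagonal
    matrix. *)
Lemma linear_part_vanishing P (f : mpoly (2 * 2) K) x :
  vanishing_ideal (diag_torus P) f -> is_diag_mx (conj22 P x) ->
  \sum_i linear_part f 0 i * mxvec x 0 i = 0.
Proof.
move=> Vf.
have inv g : diag_torus P g -> \sum_i linear_part f 0 i * mxvec g 0 i = 0.
  move=> Tg; rewrite -coef1_mmap_line.
  set p := mmap _ _ _; suff -> : p = 0 by rewrite coef0.
  suff : p * 'X = 0 by move/eqP; rewrite mulf_eq0 polyX_eq0 orbF => /eqP.
  (* The extra factor 'X discards the value 0, at which the scaled matrix is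
     not invertible. *)
  apply/eqP; apply: contrapT => /negP/closed_nonrootP[s].
  rewrite /root hornerM hornerX mulf_eq0 negb_or => /andP[ps s0].
  move: ps; rewrite horner_mmap => /eqP; apply.
  have sg : (scalar_GL2 s * g)%g = s *: GL2val g :> 'M[K]_2.
    by apply/matrixP => i j; rewrite scalar_GL2M// mxE.
  rewrite -(Vf (scalar_GL2 s * g)%g).
    apply: meval_ext => i; rewrite hornerZ hornerX.
    transitivity (mxvec (s *: GL2val g) 0 i); last by rewrite -sg.
    by rewrite linearZ mxE mulrC.
  move: Tg => /diag22P[g01 g10]; apply/diag22P.
  by rewrite sg conj22Z !mxZE g01 g10 mulr0.
move=> xd; set d := conj22 P x in xd.
(* Away from the eigenvalues of x, the matrix x - u is in the torus. *)
have /closed_nonrootP[u] : ('X - (d 0 0)%:P) * ('X - (d 1 1)%:P) != 0.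
  by rewrite mulf_neq0// polyXsubC_eq0.
rewrite rootM !root_XsubC negb_or => /andP[u0 u1].
move/diag22P: (xd) => [d01 d10].
have cE : conj22 P (x - u%:M) = d - u%:M.
  by rewrite conj22D -scaleN1r conj22Z conj22_scalar scaleN1r.
clearbody d; have dE : \det (x - u%:M) != 0.
  rewrite -(det_conj22 P) cE det22 !mxE/= d01 d10 !subr0 mulr0 subr0.
  by rewrite mulf_neq0// subr_eq0 eq_sym.
have T1 : diag_torus P 1%g by have [] := diag_torus_subgroup P.
have T2 : diag_torus P (GL2_of (x - u%:M)).
  by apply/diag22P; rewrite GL2_ofE// cE !(mxDE, mxNE, mxE)/= d01 d10 !subr0.
have := inv _ T2; have := inv _ T1; rewrite GL2_ofE// GL2_val1 => H1 H2.
have -> : \sum_i linear_part f 0 i * mxvec x 0 i =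
    \sum_i linear_part f 0 i * mxvec (x - u%:M) 0 i +
    u * \sum_i linear_part f 0 i * mxvec 1%:M 0 i.
  rewrite mulr_sumr -big_split/=; apply: eq_bigr => k _.
  case/mxvec_indexP: k => i j; rewrite !mxvecE mxDE mxNE -[u%:M]scalemx1 mxZE; ring.
by rewrite H1 H2 mulr0 addr0.
Qed.

End SplitTorus.

Section RationalTorus.
Variables (F : fieldType) (K : closedFieldType) (iota : {rmorphism F -> K}).
Implicit Types (P : GL2 K) (X : 'M[F]_2).

Lemma linear_part_map k (q : mpoly k F) :
  linear_part (map_mpoly iota q) = map_mx iota (linear_part q).
Proof. by apply/rowP => i; rewrite !mxE mcoeff_map_mpoly. Qed.

(** The ideal of the torus contains the two off-diagonal coordinates of a
    conjugate; the linear parts of the F-polynomials from which they are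
    combined cut out the algebra of the torus, so this algebra has a basis
    over F. *)
Lemma rational_generator P : defined_over iota (diag_torus P) ->
  exists2 X : 'M[F]_2, is_diag_mx (conj22 P (map_mx iota X)) &
    forall a, X != a%:M.
Proof.
move=> TF.
have coord i j : i != j -> exists k (A : 'M[F]_(k, 2 * 2)),
    (forall x, is_diag_mx (conj22 P x) ->
       mxvec x *m (map_mx iota A)^T = 0) /\
    (forall x, mxvec x *m (map_mx iota A)^T = 0 -> conj22 P x i j = 0).
  move=> ij; have /TF[k [c [q [Vq fE]]]] :
      vanishing_ideal (diag_torus P) (linear_form (conj_coord P (mxvec_index i j))).
    move=> g /is_diag_mxP gd; rewrite /mx_eval meval_linear_form -conj_coordE.
    exact: gd.
  pose A : 'M[F]_(k, 2 * 2) := \matrix_(r, s) linear_part (q r) 0 s.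
  have AE x r : (mxvec x *m (map_mx iota A)^T) 0 r =
      \sum_s linear_part (map_mpoly iota (q r)) 0 s * mxvec x 0 s.
    rewrite mxE; apply: eq_bigr => s _.
    by rewrite linear_part_map !mxE mulrC.
  exists k, A; split=> x.
    move=> xd; apply/rowP => r; rewrite AE [RHS]mxE.
    exact: linear_part_vanishing (Vq r) xd.
  move=> Ax; rewrite conj_coordE.
  rewrite -[conj_coord _ _]linear_part_linear_form fE.
  transitivity (\sum_r c r * (mxvec x *m (map_mx iota A)^T) 0 r); last first.
    by rewrite Ax big1// => r _; rewrite mxE mulr0.
  under [RHS]eq_bigr do rewrite AE mulr_sumr.
  rewrite exchange_big/=; apply: eq_bigr => s _.
  rewrite mxE raddf_sum/= mulr_suml; apply: eq_bigr => r _.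
  by rewrite mcoeffZ mxE mulrA.
have [k1 [A1 [A1P A1d]]] := coord 0 1 isT.
have [k2 [A2 [A2P A2d]]] := coord 1 0 isT.
pose A := col_mx A1 A2.
have AT : (map_mx iota A)^T = row_mx (map_mx iota A1)^T (map_mx iota A2)^T.
  by rewrite map_col_mx tr_col_mx.
pose B := kermx A^T.
have BE : map_mx iota B = kermx (map_mx iota A)^T by rewrite map_kermx map_trmx.
have LB x : is_diag_mx (conj22 P x) -> (mxvec x <= map_mx iota B)%MS.
  move=> xd; rewrite BE; apply/sub_kermxP.
  by rewrite AT mul_mx_row A1P// A2P// row_mx0.
(* The row space of B spans the algebra of the torus over K, which contains
   non-scalar matrices, so some row of B is not scalar. *)
have /row_subPn[r Br] : ~~ (B <= mxvec (1%:M : 'M[F]_2))%MS.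
  apply/negP => B1.
  pose y := invmx P *m mx22 1 0 0 0 *m P.
  have yd : conj22 P y = mx22 1 0 0 0 by rewrite conj22K.
  have : (mxvec y <= map_mx iota (mxvec (1%:M : 'M[F]_2)))%MS.
    apply: submx_trans (LB y _) _; first by rewrite yd; apply/diag22P; rewrite !mxE.
    by rewrite map_submx.
  move=> /sub_rVP[a]; rewrite map_mxvec map_mx1 -linearZ/= => /(can_inj mxvecK) ya.
  have E : mx22 1 0 0 0 = a%:M :> 'M[K]_2.
    by rewrite -yd ya scalemx1 conj22_scalar.
  have := congr1 (fun M : 'M[K]_2 => M 0 0) E.
  have := congr1 (fun M : 'M[K]_2 => M 1 1) E.
  by rewrite !mxE/= => <- /eqP; rewrite oner_eq0.
exists (vec_mx (row r B)) => [|a]; last first.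
  apply: contraNneq Br => E; apply/sub_rVP; exists a.
  by rewrite -linearZ/= scalemx1 -E vec_mxK.
have : mxvec (map_mx iota (vec_mx (row r B))) *m (map_mx iota A)^T = 0.
  rewrite -map_mxvec vec_mxK map_trmx -map_mxM -row_mul.
  by rewrite (sub_kermxP (submx_refl _)) row0 map_mx0.
rewrite AT mul_mx_row -[RHS]row_mx0 => /eq_row_mx[/A1d x01 /A2d x10].
exact/diag22P.
Qed.

(** The diagonal matrices are spanned by 1 and any one of them that is not
    scalar. *)
Lemma conj22_span P (X x : 'M[K]_2) : is_diag_mx (conj22 P X) ->
  (forall a, X != a%:M) ->
  is_diag_mx (conj22 P x) <-> exists a b, x = a%:M + b *: X.
Proof.
move=> /diag22P[X01 X10] Xns; set d := conj22 P X in X01 X10 *.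
have dd : d 0 0 != d 1 1.
  apply/eqP => dE; have /eqP[] := Xns (d 0 0).
  apply: (@conj22_inj K P); rewrite conj22_scalar -/d.
  by clearbody d; apply: eq_mx22; rewrite ?X01 ?X10 !mxE/=.
split=> [/diag22P[x01 x10]|[a [b ->]]]; last first.
  apply/diag22P; rewrite conj22D conj22Z conj22_scalar -/d !(mxDE, mxZE) X01 X10.
  by rewrite !mxE/= mulr0 addr0.
set e := conj22 P x; pose b := (e 0 0 - e 1 1) / (d 0 0 - d 1 1).
have dd' : d 0 0 - d 1 1 != 0 by rewrite subr_eq0.
exists (e 0 0 - b * d 0 0), b; apply: (@conj22_inj K P).
rewrite conj22D conj22Z conj22_scalar -/d -/e.
have sc (a : K) : [/\ (a%:M : 'M[K]_2) 0 0 = a, (a%:M : 'M[K]_2) 0 1 = 0,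
   (a%:M : 'M[K]_2) 1 0 = 0 & (a%:M : 'M[K]_2) 1 1 = a] by rewrite !mxE.
have [s00 s01 s10 s11] := sc (e 0 0 - b * d 0 0).
apply: eq_mx22; rewrite !(mxDE, mxZE) ?s00 ?s01 ?s10 ?s11.
- by rewrite subrK.
- by rewrite x01 X01 mulr0 addr0.
- by rewrite x10 X10 mulr0 addr0.
- by rewrite /b; field.
Qed.

(** The rows of the base change are left eigenvectors, read off from the matrix
    in each of the three cases: a nonzero lower entry, a nonzero upper entry, a
    diagonal matrix. *)
Lemma diagonalizable22 X r s : r != s -> X 0 0 + X 1 1 = r + s ->
  \det X = r * s -> exists P0 : GL2 F, (val P0 *m X) = mx22 r 0 0 s *m val P0.
Proof.
move=> rs tr; rewrite det22 => dt.
have EX : X 1 1 = r + s - X 0 0 by rewrite -tr addrC addKr.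
have ED : X 0 1 * X 1 0 = X 0 0 * (r + s - X 0 0) - r * s.
  by rewrite -dt EX; ring.
have sr : s - r != 0 by rewrite subr_eq0 eq_sym.
have [x10|x10] := eqVneq (X 1 0) 0; last first.
  have d0 : \det (mx22 (X 1 0) (r - X 0 0) (X 1 0) (s - X 0 0)) != 0.
    rewrite det22 !mxE/= [_ - _](_ : _ = X 1 0 * (s - r)) ?mulf_neq0//; ring.
  exists (GL2_of (mx22 (X 1 0) (r - X 0 0) (X 1 0) (s - X 0 0))).
  rewrite [val _]GL2_ofE//; apply: eq_mx22; rewrite !mulmx22 !mxE/= ?EX.
  - by ring.
  - rewrite [X 1 0 * _]mulrC ED; ring.
  - by ring.
  - rewrite [X 1 0 * _]mulrC ED; ring.
have [x01|x01] := eqVneq (X 0 1) 0; last first.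
  have d0 : \det (mx22 (r - X 1 1) (X 0 1) (s - X 1 1) (X 0 1)) != 0.
    rewrite det22 !mxE/= [_ - _](_ : _ = X 0 1 * (r - s)) ?mulf_neq0 ?subr_eq0//; ring.
  exists (GL2_of (mx22 (r - X 1 1) (X 0 1) (s - X 1 1) (X 0 1))).
  rewrite [val _]GL2_ofE//; apply: eq_mx22; rewrite !mulmx22 !mxE/= ?ED EX; ring.
have : (X 0 0 - r) * (X 0 0 - s) = 0.
  apply/eqP; rewrite -subr_eq0; apply/eqP; move: ED; rewrite x01 mul0r => ED.
  by rewrite subr0 -[RHS]oppr0 {1}ED; ring.
move=> /eqP; rewrite mulf_eq0 !subr_eq0 => /orP[]/eqP x00.
  exists 1%g; rewrite [val _]GL2_val1 mul1mx mulmx1; apply: eq_mx22;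
  by rewrite ?x01 ?x10 ?EX ?x00 !mxE//= addrC addKr.
have d0 : \det (mx22 0 1 1 0 : 'M[F]_2) != 0.
  by rewrite det22 !mxE/= mul0r mulr1 sub0r oppr_eq0 oner_eq0.
exists (GL2_of (mx22 0 1 1 0)); rewrite [val _]GL2_ofE//.
apply: eq_mx22; rewrite !mulmx22 ?x01 ?x10 ?EX ?x00 !mxE/=; ring.
Qed.

(** The second root differs from r, since a diagonalizable matrix with a double
    eigenvalue is scalar; so X is already diagonalizable over F, and with it
    the algebra that it generates. *)
Lemma split_of_root P X r : is_diag_mx (conj22 P (map_mx iota X)) ->
  (forall a, X != a%:M) ->
  r ^+ 2 - (X 0 0 + X 1 1) * r + \det X = 0 ->
  split_over iota (diag_torus P).
Proof.
move=> Xd Xns Xr; pose s := X 0 0 + X 1 1 - r.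
have ds : \det X = r * s.
  by apply/eqP; rewrite -subr_eq0 -Xr; apply/eqP; rewrite /s; ring.
have Xns' a : map_mx iota X != a%:M.
  apply/eqP => Xa; have /eqP[] := Xns (X 0 0).
  have E i j : iota (X i j) = (a%:M : 'M[K]_2) i j by rewrite -Xa mxE.
  have := E 0 0; have := E 0 1; have := E 1 0; have := E 1 1; rewrite !mxE/=.
  move=> E11 /eqP; rewrite fmorph_eq0 => /eqP x10 /eqP; rewrite fmorph_eq0 => /eqP x01 E00.
  apply: eq_mx22; rewrite !mxE//=; apply: (fmorph_inj iota).
  by rewrite E11 E00.
have rs : r != s.
  apply/eqP => rs; have /eqP[] := Xns' (iota r).
  apply: (@conj22_inj K P); rewrite conj22_scalar.
  have tr : \tr (conj22 P (map_mx iota X)) = iota (r + s).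
    rewrite /conj22 mxtrace_mulC mulmxA mulVmx ?GL2_unit// mul1mx.
    by rewrite trace_map_mx; congr (iota _); rewrite /mxtrace sum_ord2 /s; ring.
  have dt : \det (conj22 P (map_mx iota X)) = iota (r * s).
    by rewrite det_conj22 det_map_mx ds.
  move/diag22P: (Xd) => [d01 d10].
  move: tr dt; rewrite /mxtrace sum_ord2 det22 d01 mul0r subr0 -rs.
  rewrite rmorphD rmorphM/=; set d := conj22 _ _ in d01 d10 *; set q := iota r.
  move=> tr dt; have : (d 0 0 - q) ^+ 2 = 0.
    have E : d 1 1 = q + q - d 0 0 by rewrite -tr addrC addKr.
    rewrite E in dt; apply/eqP; rewrite -oppr_eq0 -(subrr (q * q)) -{1}dt.
    by apply/eqP; ring.
  move=> /eqP; rewrite expf_eq0/= subr_eq0 => /eqP d0.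
  have d1 : d 1 1 = q by apply: (@addrI _ q); rewrite -{1}d0.
  by clearbody d q; apply: eq_mx22; rewrite ?d0 ?d1 ?d01 ?d10 !mxE.
have tr : X 0 0 + X 1 1 = r + s by rewrite /s; ring.
have [P0 P0X] := diagonalizable22 rs tr ds.
exists P0 => g; rewrite /diag_torus/= => /(conj22_span g Xd Xns')[a [b gE]].
have QE : GL2_map iota P0 = map_mx iota (val P0) :> 'M[K]_2 by [].
have cX : conj22 (GL2_map iota P0) (map_mx iota X) = map_mx iota (mx22 r 0 0 s).
  rewrite /conj22 QE -map_mxM P0X map_mxM -mulmxA -QE mulmxV ?GL2_unit//.
  by rewrite mulmx1.
suff : is_diag_mx (conj22 (GL2_map iota P0) g) by []; rewrite gE.
rewrite conj22D conj22Z conj22_scalar cX; apply/diag22P.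
by rewrite !mxE/= rmorph0 mulr0 addr0.
Qed.

(** The rational points of a maximal torus that is defined but not split over
    F: the invertible elements of the quadratic field F[X] generated by the
    companion matrix X of a polynomial without roots. *)
Lemma nonsplit_torusP (T : set (GL2 K)) : maximal_torus T ->
  defined_over iota T -> ~ split_over iota T ->
  exists n t : F, (forall u v, tnorm n t u v = 0 -> u = 0 /\ v = 0) /\
    rational_points iota T = etorus n t.
Proof.
move=> /maximal_torusP[P ->] TF Tns; have [X Xd Xns] := rational_generator TF.
have noroot r : r ^+ 2 - (X 0 0 + X 1 1) * r + \det X != 0.
  by apply/eqP => Xr; apply: Tns; exact: split_of_root Xd Xns Xr.
have x10 : X 1 0 != 0.
  apply: contraNneq (noroot (X 0 0)) => x10; rewrite det22 x10 mulr0 subr0.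
  by apply/eqP; ring.
pose n := X 0 1 / X 1 0; pose t := (X 1 1 - X 0 0) / X 1 0.
exists n, t; split=> [u v uv|].
  have [v0|v0] := eqVneq v 0.
    move: uv; rewrite /tnorm v0 mulr0 expr0n/= mulr0 addr0 subr0.
    by move=> /eqP; rewrite expf_eq0/= => /eqP.
  (* A zero of the norm form is an eigenvector, and this is its eigenvalue. *)
  case/eqP: (noroot (X 1 1 + X 1 0 * (u / v))).
  have -> : (X 1 1 + X 1 0 * (u / v)) ^+ 2 - (X 0 0 + X 1 1) *
    (X 1 1 + X 1 0 * (u / v)) + \det X = (X 1 0) ^+ 2 / v ^+ 2 * tnorm n t u v.
    by rewrite det22 /tnorm /n /t; field; rewrite x10 v0.
  by rewrite uv mulr0.
have Xns' a : map_mx iota X != a%:M.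
  apply/eqP => /(congr1 (fun M : 'M[K]_2 => M 1 0)) /eqP.
  by rewrite !mxE/= fmorph_eq0 (negPf x10).
apply/seteqP; split=> g; rewrite /rational_points/= /diag_torus/=.
  move=> /(conj22_span _ Xd Xns')[a [b gE]].
  have E i j : iota (g i j) = (a%:M : 'M[K]_2) i j + b * iota (X i j).
    by have := congr1 (fun M : 'M[K]_2 => M i j) gE; rewrite !mxE.
  have := E 0 0; have := E 0 1; have := E 1 0; have := E 1 1; rewrite !mxE/=.
  move=> E11 E10 E01 E00; split; apply: (fmorph_inj iota).
    rewrite rmorphM /n rmorphM fmorphV E01 E10 !add0r.
    by field; rewrite fmorph_eq0.
  rewrite rmorphD rmorphM /t rmorphM fmorphV rmorphB E11 E10 E00 add0r.
  by field; rewrite fmorph_eq0.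
move=> [g01 g11]; apply/(conj22_span _ Xd Xns').
exists (iota (g 0 0 - g 1 0 / X 1 0 * X 0 0)), (iota (g 1 0 / X 1 0)).
apply: eq_mx22; rewrite !mxE/= ?g01 ?g11 ?add0r -?rmorphM -?rmorphD; congr (iota _).
- by rewrite subrK.
- by rewrite /n; field.
- by rewrite divfK.
- by rewrite /t; field.
Qed.

End RationalTorus.

(** * The topology of GL_2(F) *)
Section CompactCover.
Import finmap.

Lemma compact_seq_cover (T : ptopologicalType) (I : choiceType) (A : set T)
    (D : set I) (f : I -> set T) :
  compact A -> (forall i, D i -> open (f i)) -> A `<=` cover D f ->
  exists2 r : seq I, (forall i, i \in r -> D i) &
    forall x, A x -> exists2 i, i \in r & f i x.
Proof.
rewrite compact_cover => cA fo Af; have [E ED EA] := cA I D f fo Af.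
exists (enum_fset E) => [i iE|x /EA[i iE fx]]; last by exists i.
by apply: set_mem; exact: ED.
Qed.

End CompactCover.

(** In particular, each matrix entry carries ultrafilters on G to F. *)
Lemma ultra_fmap (S T : Type) (f : S -> T) (Fi : set_system S) :
  UltraFilter Fi -> UltraFilter (fmap f Fi).
Proof.
move=> FU; have PF : ProperFilter (fmap f Fi) by exact: fmap_proper_filter.
split=> // Gi GP FG; apply/seteqP; split=> // A GA.
have [//|FA] := in_ultra_setVsetC (f @^-1` A) FU.
have GC : Gi (~` A) by exact: FG.
have := filterI GA GC; rewrite setICr => G0.
by case: (@filter_not_empty _ Gi GP); exact: G0.
Qed.

Section Topology.
Variables (R : realType) (F : nonarchLocalFieldType R).
Local Notation G := (GL2 F).
Implicit Types (g h : G) (A : set G).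

Lemma GL2_max g : exists i j, (forall k l, absv (g k l) <= absv (g i j)) /\
  0 < absv (g i j).
Proof.
pose f (p : 'I_2 * 'I_2) := absv (g p.1 p.2).
have [[i j] _ ijP] := @arg_maxP _ R _ (0, 0) xpredT f isT.
have mx k l : absv (g k l) <= absv (g i j) by exact: (ijP (k, l)).
exists i, j; split=> //; rewrite lt_def absv_ge0 andbT.
apply/eqP => z0; have := GL2_det g; rewrite det22.
have gz k l : g k l = 0.
  by apply/eqP; rewrite -absv_eq0 eq_le absv_ge0 -z0 mx.
by rewrite !gz mul0r subrr eqxx.
Qed.

Lemma GL2_nbhsP g A : nbhs g A <-> exists2 e : R, 0 < e &
  forall h, (forall i j, absv (h i j - g i j) < e) -> A h.
Proof.
pose f := @GL2val F : GL2 F -> 'M[absv_space F]_2.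
split.
  rewrite nbhsE => -[B [oB Bg] BA].
  have {oB} [C oC CB] : exists2 C, open C & f @^-1` C = B by [].
  have : nbhs (f g) C by apply: open_nbhs_nbhs; split=> //; rewrite -CB in Bg.
  move=> /nbhs_ballP[e /= e0 eC]; exists e => // h gh.
  apply: BA; rewrite -CB; apply: eC; split=> // i j.
  by rewrite absv_space_ballE/= -absvN opprB gh.
move=> [e e0 eA].
have H : nbhs (f g) (ball (f g) e) by apply: nbhsx_ballx.
have {}H : nbhs g (f @^-1` ball (f g) e).
  exact: (@initial_continuous (GL2 F) _ f g _ H).
apply: filterS H => h/= [_ gh]; apply: eA => i j.
by have := gh i j; rewrite absv_space_ballE/= -absvN opprB.
Qed.

(** Bounding the determinant from below makes these sets closed among all
    matrices, hence compact; they exhaust the group. *)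
Definition compact_part (M c : R) : set G :=
  [set g : G | (forall i j, absv (g i j) <= M) /\ c <= absv (\det g)].

Lemma absv_det_near (A B : 'M[F]_2) (M e : R) :
  (forall i j, absv (A i j) <= M) -> (forall i j, absv (B i j) <= M) ->
  (forall i j, absv (A i j - B i j) <= e) -> absv (\det A - \det B) <= M * e.
Proof.
move=> AM BM AB; rewrite !det22.
have -> : A 0 0 * A 1 1 - A 0 1 * A 1 0 - (B 0 0 * B 1 1 - B 0 1 * B 1 0)
  = (A 1 1 * (A 0 0 - B 0 0) + B 0 0 * (A 1 1 - B 1 1))
    - (A 1 0 * (A 0 1 - B 0 1) + B 0 1 * (A 1 0 - B 1 0)) by ring.
by apply: absvB_le; apply: absvD_le; apply: absvM_le.
Qed.

(** The entries of an ultrafilter converge by compactness of balls in F, and the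
    limit matrix is invertible because its determinant stays away from 0. *)
Lemma compact_compact_part (M c : R) : 0 < c -> compact (compact_part M c).
Proof.
move=> c0; rewrite compact_ultra => Fi FU FC.
have FF : Filter Fi by typeclasses eauto.
have ent (i j : 'I_2) : exists a : F, absv a <= M /\
    forall e : R, 0 < e -> Fi [set g : G | absv (g i j - a) < e].
  have := @compact_absv_ball R F M; rewrite compact_ultra => cM.
  pose Fij := fmap (fun g : G => (g i j : absv_space F)) Fi.
  have FijM : Fij [set x : absv_space F | absv (x : F) <= M].
    by rewrite /Fij /fmap/=; apply: filterS FC => g [+ _]; apply.
  have [a [/= aM ca]] := cM Fij (ultra_fmap _ _) FijM; exists a; split=> // e e0.
  have /ca // : nbhs a [set x : absv_space F | absv ((x : F) - a) < e].
  by apply/absv_spaceP; exists e.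
have [a0 a0P] := choice (ent 0); have [a1 a1P] := choice (ent 1).
pose A : 'M[F]_2 := \matrix_(i, j) (if i == 0 then a0 j else a1 j).
have AP i j : absv (A i j) <= M /\
    forall e : R, 0 < e -> Fi [set g : G | absv (g i j - A i j) < e].
  by move: i; apply: forall_ord2; rewrite !mxE/=; [exact: a0P|exact: a1P].
have Anear (e : R) : 0 < e ->
    Fi [set g : G | forall i j, absv (g i j - A i j) < e].
  move=> e0; pose Q i j := (AP i j).2 e e0.
  apply: filterS (filterI (filterI (Q 0 0) (Q 0 1)) (filterI (Q 1 0) (Q 1 1))).
  by move=> g [[g00 g01] [g10 g11]]; do 2 apply: forall_ord2.
have M0 : 0 <= M by apply: le_trans (AP 0 0).1; exact: absv_ge0.
have dA : c <= absv (\det A).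
  have e0 : 0 < c / (M + 1) by rewrite divr_gt0// ltr_wpDl.
  have /filter_ex [g [gA [gM gc]]] := @filterI _ Fi FF _ _ (Anear _ e0) FC.
  rewrite (@absv_near _ _ (\det g) (\det A))//.
  apply: lt_le_trans gc; apply: (le_lt_trans (y := M * (c / (M + 1)))).
    apply: absv_det_near => // i j; last by rewrite ltW.
    by have [] := AP i j.
  have M1 : 0 < M + 1 by rewrite ltr_wpDl.
  by rewrite mulrCA gtr_pMr// ltr_pdivrMr// mul1r ltrDl.
have dA0 : \det A != 0 by rewrite -absv_gt0 (lt_le_trans c0).
exists (GL2_of A); split; first by split=> [i j|]; rewrite GL2_ofE//; have [] := AP i j.
move=> B /GL2_nbhsP[e e0 eB]; apply: filterS (Anear _ e0) => g gA.
by apply: eB => i j; rewrite GL2_ofE.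
Qed.

Lemma GL2_closed_compact (M c : R) A : 0 < c -> open (~` A) ->
  A `<=` compact_part M c -> compact A.
Proof.
move=> c0 oA AM; apply: (subclosed_compact _ (@compact_compact_part M c c0) AM).
by rewrite -[A]setCK; exact: open_closedC.
Qed.

(** For e < 1 this is an open subgroup, a congruence subgroup of level e. *)
Definition ball1 (e : R) : set G :=
  [set g : G | forall i j, absv (g i j - (1%:M : 'M[F]_2) i j) <= e].

Lemma ball1P e g : [/\ absv (g 0 0 - 1) <= e, absv (g 0 1) <= e,
  absv (g 1 0) <= e & absv (g 1 1 - 1) <= e] <-> ball1 e g.
Proof.
split=> [[]|gb].
  by move=> *; apply: forall_ord2; apply: forall_ord2; rewrite mxE/= ?subr0.
have := gb 0 0; have := gb 0 1; have := gb 1 0; have := gb 1 1.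
by rewrite !mxE/= !subr0.
Qed.

Lemma ball1_le1 e g : e < 1 -> ball1 e g -> forall i j, absv (g i j) <= 1.
Proof.
move=> e1 gb i j; rewrite -[g i j](subrK ((1%:M : 'M[F]_2) i j)).
apply: absvD_le; first by rewrite (le_trans (gb i j))// ltW.
by rewrite mxE; case: eqP; rewrite ?absv1// absv0.
Qed.

Lemma ball1_det e g : e < 1 -> ball1 e g ->
  absv (\det g - 1) <= e /\ absv (\det g) = 1.
Proof.
move=> e1 gb; have dg : absv (\det g - 1) <= e.
  rewrite -(det1 F 2) -[leRHS]mul1r; apply: absv_det_near => // i j.
    exact: ball1_le1 gb i j.
  by rewrite mxE; case: eqP; rewrite ?absv1// absv0.
by split=> //; apply: absv_near1; exact: le_lt_trans e1.
Qed.

Lemma ball1_subgroup e : 0 <= e < 1 -> is_subgroup (ball1 e).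
Proof.
move=> /andP[e0 e1]; split.
- by move=> i j; rewrite GL2_val1 subrr absv0.
- move=> g h gb hb i j.
  have -> : (g * h)%g i j - (1%:M : 'M[F]_2) i j =
     ((g 0 0 - 1) * h 0 j * (i == 0)%:R + g 0 1 * h 1 j * (i == 0)%:R) +
     (g 1 0 * h 0 j * (i == 1)%:R + (g 1 1 - 1) * h 1 j * (i == 1)%:R)
     + (h i j - (1%:M : 'M[F]_2) i j).
    by move: i; apply: forall_ord2; rewrite GL2_mul_entry mxE/=; ring.
  apply: absvD_le => //; move/ball1P : gb => [g00 g01 g10 g11].
  have h1 := ball1_le1 e1 hb.
  have b1 (b : bool) : absv (b%:R : F) <= 1 by case: b; rewrite ?absv1 ?absv0.
  by apply: absvD_le; apply: absvD_le; rewrite -[e]mulr1; apply: absvM_le => //;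
    rewrite -[e]mulr1; exact: absvM_le.
- move=> g gb; have [d1 d2] := ball1_det e1 gb.
  have [v00 v01 v10 v11] := GL2_inv_entries g; have dg := GL2_det g.
  move/ball1P : (gb) => [g00 g01 g10 g11].
  have dd (x : F) : absv x <= e -> absv (x / \det g) <= e.
    by move=> xe; rewrite absvM absvV d2 invr1 mulr1.
  have aux (x : F) : absv (x - 1) <= e -> absv (x / \det g - 1) <= e.
    move=> xe; have -> : x / \det g - 1 = ((x - 1) - (\det g - 1)) / \det g by field.
    by apply: dd; exact: absvB_le.
  apply/ball1P; rewrite v00 v01 v10 v11.
  split; [exact: aux | | | exact: aux]; by apply: dd; rewrite absvN.
Qed.

Lemma ball1_compact_part e : e < 1 -> ball1 e `<=` compact_part 1 1.
Proof.
move=> e1 g gb; split; first exact: ball1_le1 gb.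
by rewrite (ball1_det e1 gb).2.
Qed.

Lemma nbhs1_ball1 A : nbhs (1%g : G) A -> exists2 e : R, 0 < e < 1 & ball1 e `<=` A.
Proof.
move=> /GL2_nbhsP[e e0 eA].
exists (Num.min (e / 2) (1 / 2)).
  by rewrite lt_min !divr_gt0//= gt_min; apply/orP; right; lra.
move=> g gb; apply: eA => i j; apply: le_lt_trans (gb i j) _.
by rewrite gt_min; apply/orP; left; lra.
Qed.

Lemma ball1_nbhs1 e : 0 < e -> nbhs (1%g : G) (ball1 e).
Proof. by move=> e0; apply/GL2_nbhsP; exists e => // h he i j; apply/ltW/he. Qed.

Lemma nbhs_mull g h A : nbhs (g * h)%g A -> nbhs h [set x | A (g * x)%g].
Proof.
move=> /GL2_nbhsP[e e0 eA]; apply/GL2_nbhsP.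
have [i0 [j0 [gm m0]]] := GL2_max g; set m := absv _ in gm m0.
exists (e / (m * 2)); first by rewrite divr_gt0// mulr_gt0.
move=> x xh; apply: eA => i j; rewrite !GL2_mul_entry.
have -> : g i 0 * x 0 j + g i 1 * x 1 j - (g i 0 * h 0 j + g i 1 * h 1 j) =
  g i 0 * (x 0 j - h 0 j) + g i 1 * (x 1 j - h 1 j) by ring.
have : m * (e / (m * 2)) < e.
  have -> : m * (e / (m * 2)) = e / 2 by field; rewrite gt_eqF.
  lra.
by apply: le_lt_trans; apply: absvD_le; apply: absvM_le; rewrite // ltW.
Qed.

Lemma nbhs_mulr g h A : nbhs (g * h)%g A -> nbhs g [set x | A (x * h)%g].
Proof.
move=> /GL2_nbhsP[e e0 eA]; apply/GL2_nbhsP.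
have [i0 [j0 [gm m0]]] := GL2_max h; set m := absv _ in gm m0.
exists (e / (m * 2)); first by rewrite divr_gt0// mulr_gt0.
move=> x xg; apply: eA => i j; rewrite !GL2_mul_entry.
have -> : x i 0 * h 0 j + x i 1 * h 1 j - (g i 0 * h 0 j + g i 1 * h 1 j) =
  h 0 j * (x i 0 - g i 0) + h 1 j * (x i 1 - g i 1) by ring.
have : m * (e / (m * 2)) < e.
  have -> : m * (e / (m * 2)) = e / 2 by field; rewrite gt_eqF.
  lra.
by apply: le_lt_trans; apply: absvD_le; apply: absvM_le; rewrite // ltW.
Qed.

End Topology.

(** * Boundedness modulo the center and the elliptic torus *)
Section Bounded.
Variables (R : realType) (F : nonarchLocalFieldType R).
Local Notation G := (GL2 F).
Implicit Types (g h x y : G).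

(** Both sides are homogeneous of degree 2, so this is a condition on the class
    of g modulo the center; the sets that it defines are compact there, and
    they are stable under products and inverses up to a change of C. *)
Definition bdd (C : R) g :=
  forall i j k l, absv (g i j) * absv (g k l) <= C * absv (\det g).

Lemma bddM (C D : R) g h : bdd C g -> bdd D h -> bdd (C * D) (g * h)%g.
Proof.
move=> gC hD i j k l; rewrite -absvM GL2_detM !GL2_mul_entry.
have -> : (g i 0 * h 0 j + g i 1 * h 1 j) * (g k 0 * h 0 l + g k 1 * h 1 l)
 = (g i 0 * g k 0) * (h 0 j * h 0 l) + (g i 0 * g k 1) * (h 0 j * h 1 l) +
  ((g i 1 * g k 0) * (h 1 j * h 0 l) + (g i 1 * g k 1) * (h 1 j * h 1 l)) by ring.
rewrite absvM [leRHS]mulrACA.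
by do 2 apply: absvD_le; apply: absvM_le; rewrite absvM; (exact: gC || exact: hD).
Qed.

Lemma GL2_inv_entry g i j : exists k l,
  absv ((g^-1)%g i j) = absv (g k l) / absv (\det g).
Proof.
have [v00 v01 v10 v11] := GL2_inv_entries g.
case: (ord2P i) => ->; case: (ord2P j) => ->;
  [exists 1, 1|exists 0, 1|exists 1, 0|exists 0, 0];
  by rewrite ?v00 ?v01 ?v10 ?v11 absvM absvV ?absvN.
Qed.

Lemma bddV (C : R) g : bdd C g -> bdd C (g^-1)%g.
Proof.
move=> gC i j k l; have [i1 [j1 ->]] := GL2_inv_entry g i j.
have [k1 [l1 ->]] := GL2_inv_entry g k l.
have d0 : 0 < absv (\det g) by rewrite absv_gt0 GL2_det.
rewrite GL2_detV absvV mulrACA -invfM ler_pdivrMr ?mulr_gt0//.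
by rewrite mulrA mulfVK ?gt_eqF//; exact: gC.
Qed.

Lemma bdd_le (C D : R) g : C <= D -> bdd C g -> bdd D g.
Proof.
move=> CD gC i j k l; apply: le_trans (gC i j k l) _.
by rewrite ler_wpM2r ?absv_ge0.
Qed.

Lemma bdd_gt0 (C : R) g : bdd C g -> 0 < C.
Proof.
move=> gC; have [i [j [_ m0]]] := GL2_max g.
have := lt_le_trans (mulr_gt0 m0 m0) (gC i j i j).
by rewrite pmulr_lgt0// absv_gt0 GL2_det.
Qed.

Lemma bdd_center z : group_center z -> bdd 1 z.
Proof.
move=> /GL2_centerP[z01 z10 z00] i j k l.
rewrite mul1r det22 z01 mul0r subr0 absvM z00.
case: (ord2P i) => ->; case: (ord2P j) => ->; case: (ord2P k) => ->;
  by case: (ord2P l) => ->; rewrite ?z00 ?z01 ?z10 ?absv0 ?mul0r ?mulr0 ?mulr_ge0 ?absv_ge0.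
Qed.

Lemma bdd_of_ball1 (e : R) g : e < 1 -> ball1 e g -> bdd 1 g.
Proof.
move=> e1 gb i j k l; rewrite (ball1_det e1 gb).2 mulr1.
by rewrite mulr_ile1 ?absv_ge0// (ball1_le1 e1 gb).
Qed.

Lemma bdd_exists g : exists C : R, bdd C g.
Proof.
have [i [j [mx m0]]] := GL2_max g.
exists (absv (g i j) ^+ 2 / absv (\det g)) => a b c d.
by rewrite mulfVK ?absv_eq0 ?GL2_det// expr2 ler_pM ?absv_ge0.
Qed.

(** Dividing by the largest entry normalizes g. *)
Lemma bdd_scale (C : R) g : bdd C g ->
  exists2 a : F, a != 0 & compact_part 1 C^-1 (scalar_GL2 a * g)%g.
Proof.
move=> gC; have C0 := bdd_gt0 gC; have [i [j [mx m0]]] := GL2_max g.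
have a0 : (g i j)^-1 != 0 by rewrite invr_eq0 -absv_gt0.
exists (g i j)^-1 => //; split=> [k l|].
  by rewrite scalar_GL2M// absvM absvV mulrC ler_pdivrMr// mul1r.
rewrite scalar_GL2_det// absvM absvX absvV.
rewrite -div1r ler_pdivrMr// exprVn -mulrA ler_pdivlMl ?exprn_gt0// mulr1.
by rewrite expr2 mulrC [leRHS]mulrC; exact: gC.
Qed.

Lemma bdd_conj_ball1 (C e : R) g x : bdd C x -> ball1 (e / C) g ->
  ball1 e (x * g * x^-1)%g.
Proof.
move=> xC gb i j; have C0 := bdd_gt0 xC; have dx := GL2_det x.
have -> : (x * g * x^-1)%g i j - (1%:M : 'M[F]_2) i j =
   (x i 0 * (x^-1)%g 0 j * (g 0 0 - (1%:M : 'M[F]_2) 0 0) +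
    x i 0 * (x^-1)%g 1 j * (g 0 1 - (1%:M : 'M[F]_2) 0 1)) +
   (x i 1 * (x^-1)%g 0 j * (g 1 0 - (1%:M : 'M[F]_2) 1 0) +
    x i 1 * (x^-1)%g 1 j * (g 1 1 - (1%:M : 'M[F]_2) 1 1)).
  have e1 : (1%:M : 'M[F]_2) i j = x i 0 * (x^-1)%g 0 j + x i 1 * (x^-1)%g 1 j.
    by rewrite -GL2_mul_entry mulgV.
  rewrite [in LHS]e1 !GL2_mul_entry !mxE/=; ring.
have xx k l : absv (x i k * (x^-1)%g l j) <= C.
  have [k1 [l1 e1]] := GL2_inv_entry x l j.
  by rewrite absvM e1 mulrA ler_pdivrMr ?absv_gt0.
have -> : e = C * (e / C) by rewrite mulrC divfK ?gt_eqF.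
by do 2 apply: absvD_le; apply: absvM_le.
Qed.

(** The pattern of the key estimate: if y is close to 1 and fixes the column
    of x that contains its largest entry, then conjugation by x does not move
    y away from 1. *)
Lemma ball1_conj_fix (e : R) x y i j : ball1 e y ->
  (forall k l, absv (x k l) <= absv (x i j)) -> 0 < absv (x i j) ->
  (forall k, y k 0 * x 0 j + y k 1 * x 1 j = x k j) ->
  ball1 e (x^-1 * y * x)%g.
Proof.
move=> /ball1P[y00 y01 y10 y11] xm x0 yx.
have xij0 : x i j != 0 by rewrite -absv_gt0.
have rat k l : absv (x k l / x i j) <= 1.
  by rewrite absvM absvV ler_pdivrMr// mul1r.
(* The nontrivial column of the conjugate of y by x is a combination of entries
   of y - 1 with coefficients of absolute value at most 1. *)
have ye k k' l a b : absv a <= e -> absv b <= e ->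
    absv (x k l / x i j * a - x k' l / x i j * b) <= e.
  by move=> ae be; rewrite -[e]mul1r; apply: absvB_le; apply: absvM_le.
suff [T Tb xT] : exists2 T : 'M[F]_2, [/\ absv (T 0 0 - 1) <= e,
    absv (T 0 1) <= e, absv (T 1 0) <= e & absv (T 1 1 - 1) <= e] &
    x *m T = y *m x.
  apply/ball1P; suff -> : (x^-1 * y * x)%g = T :> 'M[F]_2 by [].
  rewrite -mulgA GL2_valM GL2_valM -xT mulmxA -GL2_valM mulVg GL2_val1.
  by rewrite mul1mx.
have e0 : 0 <= e by apply: le_trans y01; exact: absv_ge0.
have dx := GL2_det x; rewrite det22 in dx.
have := yx 0; have := yx 1; move: ye rat xij0; rewrite {xm x0 yx}.
case: (ord2P i) => ->; case: (ord2P j) => -> ye rat xij0 yx1 yx0.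
- have E0 : y 0 0 = (x 0 0 - y 0 1 * x 1 0) / x 0 0.
    by apply: (mulIf xij0); rewrite divfK// -[X in _ = X - _]yx0; ring.
  have E1 : y 1 0 = (x 1 0 - y 1 1 * x 1 0) / x 0 0.
    by apply: (mulIf xij0); rewrite divfK// -[X in _ = X - _]yx1; ring.
  exists (mx22 1 (x 1 1 / x 0 0 * y 0 1 - x 0 1 / x 0 0 * (y 1 1 - 1))
    0 (1 + (x 0 0 / x 0 0 * (y 1 1 - 1) - x 1 0 / x 0 0 * y 0 1))).
    rewrite !mxE/= subrr absv0; split=> //; first exact: (ye 1 0 1).
    by rewrite addrAC subrr add0r; exact: (ye 0 1 0).
  by apply: eq_mx22; rewrite !mulmx22 !mxE/= ?E0 ?E1; field.
- have E0 : y 0 0 = (x 0 1 - y 0 1 * x 1 1) / x 0 1.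
    by apply: (mulIf xij0); rewrite divfK// -[X in _ = X - _]yx0; ring.
  have E1 : y 1 0 = (x 1 1 - y 1 1 * x 1 1) / x 0 1.
    by apply: (mulIf xij0); rewrite divfK// -[X in _ = X - _]yx1; ring.
  exists (mx22 (1 + (x 0 1 / x 0 1 * (y 1 1 - 1) - x 1 1 / x 0 1 * y 0 1)) 0
    (x 1 0 / x 0 1 * y 0 1 - x 0 0 / x 0 1 * (y 1 1 - 1)) 1).
    rewrite !mxE/= subrr absv0; split=> //; last exact: (ye 1 0 0).
    by rewrite addrAC subrr add0r; exact: (ye 0 1 1).
  by apply: eq_mx22; rewrite !mulmx22 !mxE/= ?E0 ?E1; field.
- have E0 : y 0 1 = (x 0 0 - y 0 0 * x 0 0) / x 1 0.
    by apply: (mulIf xij0); rewrite divfK// -[X in _ = X - _]yx0; ring.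
  have E1 : y 1 1 = (x 1 0 - y 1 0 * x 0 0) / x 1 0.
    by apply: (mulIf xij0); rewrite divfK// -[X in _ = X - _]yx1; ring.
  exists (mx22 1 (x 0 1 / x 1 0 * y 1 0 - x 1 1 / x 1 0 * (y 0 0 - 1))
    0 (1 + (x 1 0 / x 1 0 * (y 0 0 - 1) - x 0 0 / x 1 0 * y 1 0))).
    rewrite !mxE/= subrr absv0; split=> //; first exact: (ye 0 1 1).
    by rewrite addrAC subrr add0r; exact: (ye 1 0 0).
  by apply: eq_mx22; rewrite !mulmx22 !mxE/= ?E0 ?E1; field.
- have E0 : y 0 1 = (x 0 1 - y 0 0 * x 0 1) / x 1 1.
    by apply: (mulIf xij0); rewrite divfK// -[X in _ = X - _]yx0; ring.
  have E1 : y 1 1 = (x 1 1 - y 1 0 * x 0 1) / x 1 1.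
    by apply: (mulIf xij0); rewrite divfK// -[X in _ = X - _]yx1; ring.
  exists (mx22 (1 + (x 1 1 / x 1 1 * (y 0 0 - 1) - x 0 1 / x 1 1 * y 1 0)) 0
    (x 0 0 / x 1 1 * y 1 0 - x 1 0 / x 1 1 * (y 0 0 - 1)) 1).
    rewrite !mxE/= subrr absv0; split=> //; last exact: (ye 0 1 0).
    by rewrite addrAC subrr add0r; exact: (ye 1 0 1).
  by apply: eq_mx22; rewrite !mulmx22 !mxE/= ?E0 ?E1; field.
Qed.
End Bounded.

Section EllipticTorus.
Variables (R : realType) (F : nonarchLocalFieldType R) (n t : F).
Local Notation G := (GL2 F).
Implicit Types (g h x y : G) (u v : F).

Local Notation tnorm := (tnorm n t).
Local Notation tmx := (tmx n t).
Local Notation etorus := (etorus n t).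

Hypothesis anisotropic : forall u v, tnorm u v = 0 -> u = 0 /\ v = 0.

(** The absolute value of the polynomial is locally constant and positive on a
    compact ball. *)
Lemma quadratic_lower_bound (a b c : F) :
  (forall x : F, a + b * x + c * x ^+ 2 != 0) ->
  exists2 d : R, 0 < d &
    forall x : F, absv x <= 1 -> d <= absv (a + b * x + c * x ^+ 2).
Proof.
move=> f0; pose f (x : F) := a + b * x + c * x ^+ 2.
have := @compact_absv_ball R F 1; rewrite compact_near_coveringP.
move=> /(_ nat \oo (fun k (x : absv_space F) => k.+1%:R^-1 < absv (f x)) _) [].
  move=> x /= x1; pose m := 1 + absv b + absv c.
  have m0 : 0 < m by rewrite /m -addrA ltr_pwDl ?addr_ge0 ?absv_ge0.
  have fx0 : 0 < absv (f x) by rewrite absv_gt0 f0.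
  have e0 : 0 < Num.min 1 (absv (f x) / m) by rewrite lt_min ltr01 divr_gt0.
  exists ([set y : absv_space F | absv ((y : F) - x) < Num.min 1 (absv (f x) / m)],
    [set k : nat | k.+1%:R^-1 < absv (f x)]).
    split=> /=; first by apply/absv_spaceP; eexists; [exact: e0|].
    exact: near_infty_natSinv_lt (PosNum fx0).
  move=> [y k] /= [yx kx]; move: yx; rewrite lt_min => /andP[yx1 yx].
  have y1 : absv y <= 1.
    by rewrite -[y : F](subrK x); apply: absvD_le; rewrite // ltW.
  rewrite /= (@absv_near _ _ (f x) (f y))//.
  have -> : f x - f y = (x - y) * (b + c * (x + y)) by rewrite /f; ring.
  move: yx; rewrite ltr_pdivlMr// => /(le_lt_trans _); apply.
  rewrite absvM -opprB absvN ler_wpM2l ?absv_ge0//.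
  apply: absvD_le; first by rewrite /m addrAC lerDr ?addr_ge0 ?absv_ge0.
  apply: (le_trans (y := absv c)).
    rewrite absvM ler_piMr ?absv_ge0//; exact: absvD_le.
  by rewrite /m lerDr addr_ge0 ?absv_ge0.
move=> k _ /(_ k (leqnn k)) H; exists (k.+1%:R^-1); first by rewrite invr_gt0.
by move=> x x1; apply/ltW/H.
Qed.

(** By homogeneity the larger of u and v may be taken equal to 1. *)
Lemma tnorm_lower_bound : exists2 c : R, 0 < c & forall u v,
  c * absv u ^+ 2 <= absv (tnorm u v) /\ c * absv v ^+ 2 <= absv (tnorm u v).
Proof.
have [c1 c10 H1] : exists2 d : R, 0 < d & forall x : F, absv x <= 1 ->
    d <= absv (1 + t * x + (- n) * x ^+ 2).
  apply: quadratic_lower_bound => x; apply/eqP => x0.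
  have [/eqP] : 1 = 0 :> F /\ x = 0.
    by apply: anisotropic; rewrite -[RHS]x0 /tnorm; ring.
  by rewrite oner_eq0.
have [c2 c20 H2] : exists2 d : R, 0 < d & forall x : F, absv x <= 1 ->
    d <= absv (- n + t * x + 1 * x ^+ 2).
  apply: quadratic_lower_bound => x; apply/eqP => x0.
  have [_ /eqP] : x = 0 /\ 1 = 0 :> F.
    by apply: anisotropic; rewrite -[RHS]x0 /tnorm; ring.
  by rewrite oner_eq0.
have c0 : 0 < Num.min c1 c2 by rewrite lt_min c10.
exists (Num.min c1 c2) => // u v.
wlog: / u != 0 \/ v != 0.
  have [-> H|u0 H] := eqVneq u 0; last by apply: H; left.
  have [->|v0] := eqVneq v 0; last by apply: H; right.
  by rewrite !absv0 expr0n/= mulr0 absv_ge0.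
move=> uv0.
have [vu|uv] := leP (absv v) (absv u).
  have u0 : u != 0.
    case: uv0 => // v0; apply: contraTneq vu => ->.
    by rewrite absv0 -ltNge absv_gt0.
  have H : c1 * absv u ^+ 2 <= absv (tnorm u v).
    have -> : tnorm u v = (1 + t * (v / u) + (- n) * (v / u) ^+ 2) * u ^+ 2.
      by rewrite /tnorm; field.
    rewrite absvM absvX ler_wpM2r ?exprn_ge0 ?absv_ge0//; apply: H1.
    by rewrite absvM absvV ler_pdivrMr ?absv_gt0// mul1r.
  split; apply: le_trans H.
    by rewrite ler_wpM2r ?exprn_ge0 ?absv_ge0// ge_min lexx.
  apply: ler_pM; rewrite ?(ltW c0) ?exprn_ge0 ?absv_ge0 ?ge_min ?lexx//.
  by rewrite lerXn2r ?nnegrE ?absv_ge0.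
have v0 : v != 0 by rewrite -absv_gt0 (le_lt_trans _ uv)// absv_ge0.
have H : c2 * absv v ^+ 2 <= absv (tnorm u v).
  have -> : tnorm u v = (- n + t * (u / v) + 1 * (u / v) ^+ 2) * v ^+ 2.
    by rewrite /tnorm; field.
  rewrite absvM absvX ler_wpM2r ?exprn_ge0 ?absv_ge0//; apply: H2.
  by rewrite absvM absvV ler_pdivrMr ?absv_gt0// mul1r ltW.
split; apply: le_trans H.
  apply: ler_pM; rewrite ?(ltW c0) ?exprn_ge0 ?absv_ge0 ?ge_min ?lexx ?orbT//.
  by rewrite lerXn2r ?nnegrE ?absv_ge0 ?ltW.
by rewrite ler_wpM2r ?exprn_ge0 ?absv_ge0// ge_min lexx orbT.
Qed.

Definition tbound : R := 1 + absv n + absv t.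

Lemma tbound_gt0 : 0 < tbound.
Proof. by rewrite /tbound -addrA ltr_pwDl ?addr_ge0 ?absv_ge0. Qed.

Lemma tmx_le (r : R) u v : absv u <= r -> absv v <= r ->
  forall i j, absv (tmx u v i j) <= tbound * r.
Proof.
move=> ur vr; have r0 : 0 <= r by apply: le_trans ur; exact: absv_ge0.
have le1 (x : F) : absv x <= r -> absv x <= tbound * r.
  move=> xr; apply: (le_trans xr); rewrite ler_peMl// /tbound -addrA lerDl.
  by rewrite addr_ge0 ?absv_ge0.
do 2 apply: forall_ord2; rewrite mxE/=; try exact: le1.
  apply: absvM_le => //; rewrite /tbound addrAC lerDr.
  by rewrite addr_ge0 ?absv_ge0.
apply: absvD_le; first exact: le1.
by apply: absvM_le => //; rewrite /tbound lerDr addr_ge0 ?absv_ge0.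
Qed.

(** All entries of an element are controlled by its first column, and so is its
    determinant, from below. *)
Lemma etorus_bdd : exists C : R, forall h, etorus h -> bdd C h.
Proof.
have [c c0 cP] := tnorm_lower_bound; exists (tbound ^+ 2 / c) => h Hh i j k l.
rewrite (etorusE Hh) det_tmx; have [cu cv] := cP (h 0 0) (h 1 0).
have tb := tmx_le; have tb0 := tbound_gt0.
set u := h 0 0 in cu *; set v := h 1 0 in cv *.
have [r [ur [vr cr]]] : exists r : R, absv u <= r /\ absv v <= r /\
    c * r ^+ 2 <= absv (tnorm u v).
  have [vu|/ltW uv] := leP (absv v) (absv u); first by exists (absv u).
  by exists (absv v).
have r0 : 0 <= r by apply: le_trans ur; exact: absv_ge0.
apply: (le_trans (y := (tbound * r) * (tbound * r))).
  by apply: ler_pM; rewrite ?absv_ge0// tb.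
have -> : tbound * r * (tbound * r) = tbound ^+ 2 / c * (c * r ^+ 2).
  by field; rewrite gt_eqF.
by rewrite ler_wpM2l// divr_ge0 ?exprn_ge0 ?ltW.
Qed.

(** The geometric heart of the theorem: [etorus] acts simply transitively on
    the nonzero vectors of the plane, so an element g close to 1 can be
    corrected by an element h of [etorus] close to 1 in such a way that h g
    fixes any prescribed vector.  Prescribing the largest column of x makes
    the conjugate of h g by x close to 1, uniformly in x. *)
Lemma etorus_correction (e : R) : 0 < e < 1 -> exists2 d : R, 0 < d &
  forall g, ball1 d g -> forall x, exists2 h, etorus h &
    ball1 e (x^-1 * (h * g) * x)%g.
Proof.
move=> /andP[e0 e1]; have [c c0 cP] := tnorm_lower_bound; have tb0 := tbound_gt0.
(* h is the inverse of the element that carries the column v to w = g v; its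
   distance to 1 is at most tbound^2 / c times that of w to v, relative to the
   size of v. *)
pose d := Num.min e (e * c / tbound ^+ 2).
have de : d <= e by rewrite ge_min lexx.
have dc : d <= e * c / tbound ^+ 2 by rewrite ge_min lexx orbT.
have d0 : 0 < d by rewrite lt_min e0 divr_gt0 ?mulr_gt0 ?exprn_gt0.
exists d => // g gd x; have [i [j [xm x0]]] := GL2_max x.
pose v k := x k j; pose w k := g k 0 * v 0 + g k 1 * v 1.
have d1 : d < 1 by exact: le_lt_trans e1.
have wv k : absv (w k - v k) <= d * absv (x i j).
  have -> : w k - v k = (g k 0 - (1%:M : 'M[F]_2) k 0) * v 0 +
      (g k 1 - (1%:M : 'M[F]_2) k 1) * v 1.
    by move: k; apply: forall_ord2; rewrite /w !mxE/=; ring.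
  by apply: absvD_le; apply: absvM_le; rewrite ?gd ?xm.
have nv : tnorm (v 0) (v 1) != 0.
  apply/eqP => /anisotropic[v0 v1]; move: x0.
  by case: (ord2P i) => ->; rewrite -/(v _) ?v0 ?v1 absv0 ltxx.
have nw : tnorm (w 0) (w 1) != 0.
  apply/eqP => /anisotropic[w0 w1]; have := wv i.
  have -> : w i = 0 by case: (ord2P i) => ->.
  by rewrite sub0r absvN ler_pMl// leNgt d1.
pose Hv := GL2_of (tmx (v 0) (v 1)); pose Hw := GL2_of (tmx (w 0) (w 1)).
have EHv : Hv = tmx (v 0) (v 1) :> 'M[F]_2 by rewrite GL2_ofE// det_tmx.
have EHw : Hw = tmx (w 0) (w 1) :> 'M[F]_2 by rewrite GL2_ofE// det_tmx.
have [_ HM HV] := etorus_subgroup n t.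
have tHv := etorus_tmx nv; have tHw := etorus_tmx nw.
exists (Hv * Hw^-1)%g; first by apply: HM => //; exact: HV.
have vV k : (Hv^-1)%g k 0 * v 0 + (Hv^-1)%g k 1 * v 1 = (1%:M : 'M[F]_2) k 0.
  by rewrite -GL2_val1 -(mulVg Hv) GL2_mul_entry EHv !mxE.
have wV k : (Hw^-1)%g k 0 * w 0 + (Hw^-1)%g k 1 * w 1 = (1%:M : 'M[F]_2) k 0.
  by rewrite -GL2_val1 -(mulVg Hw) GL2_mul_entry EHw !mxE.
have bh : ball1 e (Hw * Hv^-1)%g.
  move=> k l.
  have -> : (Hw * Hv^-1)%g k l - (1%:M : 'M[F]_2) k l =
     tmx (w 0 - v 0) (w 1 - v 1) k 0 * (Hv^-1)%g 0 l +
     tmx (w 0 - v 0) (w 1 - v 1) k 1 * (Hv^-1)%g 1 l.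
    have -> : (1%:M : 'M[F]_2) k l = Hv k 0 * (Hv^-1)%g 0 l + Hv k 1 * (Hv^-1)%g 1 l.
      by rewrite -GL2_mul_entry mulgV.
    rewrite GL2_mul_entry EHw EHv; move: k; apply: forall_ord2; rewrite !mxE/=; ring.
  have [cu cv] := cP (v 0) (v 1).
  have ci : c * absv (x i j) ^+ 2 <= absv (tnorm (v 0) (v 1)).
    by case: (ord2P i) => ->.
  have Vle a : absv ((Hv^-1)%g a l) <= tbound / (c * absv (x i j)).
    have [a' [l' ->]] := GL2_inv_entry Hv a l.
    rewrite EHv det_tmx ler_pdivrMr ?absv_gt0//.
    apply: (le_trans (tmx_le (xm 0 j) (xm 1 j) a' l')).
    have -> : tbound * absv (x i j) =
       tbound / (c * absv (x i j)) * (c * absv (x i j) ^+ 2).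
      by field; rewrite !gt_eqF.
    by rewrite ler_wpM2l// divr_ge0 ?mulr_ge0 ?ltW.
  have te : tbound * (d * absv (x i j)) * (tbound / (c * absv (x i j))) <= e.
    have -> : tbound * (d * absv (x i j)) * (tbound / (c * absv (x i j)))
        = d * (tbound ^+ 2 / c) by field; rewrite !gt_eqF.
    by rewrite -ler_pdivlMr ?divr_gt0 ?exprn_gt0// invf_div mulrA.
  apply: le_trans te; apply: absvD_le; apply: absvM_le => //;
    exact: tmx_le.
have [_ bM bV] := @ball1_subgroup R F e (introT andP (conj (ltW e0) e1)).
have bg : ball1 e g by move=> k l; exact: le_trans (gd k l) de.
apply: (@ball1_conj_fix _ _ _ _ _ i j) => //.
  have -> : (Hv * Hw^-1 = (Hw * Hv^-1)^-1)%g by rewrite invgM invgK.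
  by apply: bM => //; exact: bV.
move=> k; rewrite -/(v 0) -/(v 1) -/(v k) !GL2_mul_entry.
set a := (Hw^-1)%g; set b := Hv.
have -> : v k = b k 0 * (a 0 0 * w 0 + a 0 1 * w 1) + b k 1 * (a 1 0 * w 0 + a 1 1 * w 1).
  rewrite !wV /b EHv !mxE/=; move: k; apply: forall_ord2 => /=; ring.
by rewrite /w; ring.
Qed.

End EllipticTorus.

(** * Coset spaces *)
Section Cosets.
Variables (R : realType) (F : nonarchLocalFieldType R).
Local Notation G := (GL2 F).
Implicit Types (g h x : G) (A P S : set G).

Definition rstable S A := forall g s, A g -> S s -> A (g * s)%g.

(** The image of A in G/S when A is right S-stable; in terms of representatives,
    membership unfolds to membership in A. *)
Definition hat S A : set (coset_space S) := [set q | A (coset_repr q)].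
Local Arguments hat : clear implicits.

Lemma coset_projP S g h : is_subgroup S ->
  coset_proj S g = coset_proj S h <-> S (g^-1 * h)%g.
Proof.
move=> [S1 SM SV]; rewrite /coset_proj; split=> [/eqquotP/asboolP E|Sgh].
  have : mulset [set h] S h by exists h => //; exists 1%g => //; rewrite mulg1.
  by rewrite -E => -[_ -> [s Ss <-]]; rewrite mulKg.
apply/eqquotP/asboolP/seteqP; split=> x [_ -> [s Ss <-]].
  exists h => //; exists (h^-1 * g * s)%g; last by rewrite !mulgA mulgV mul1g.
  by apply: SM => //; have := SV _ Sgh; rewrite invgM invgK.
exists g => //; exists (g^-1 * h * s)%g; last by rewrite !mulgA mulgV mul1g.
exact: SM.
Qed.

Lemma coset_reprK S : cancel (@coset_repr R F S) (coset_proj S).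
Proof. by move=> q; exact: reprK. Qed.

Lemma coset_repr_proj S g : is_subgroup S ->
  exists2 s, S s & coset_repr (coset_proj S g) = (g * s)%g.
Proof.
move=> SS; exists (g^-1 * coset_repr (coset_proj S g))%g; last by rewrite mulVKg.
by apply/(coset_projP _ _ SS); rewrite coset_reprK.
Qed.

Lemma hat_proj S A g : is_subgroup S -> rstable S A ->
  hat S A (coset_proj S g) <-> A g.
Proof.
move=> SS AS; have [s Ss sE] := coset_repr_proj g SS; rewrite /hat/= sE.
split=> [Ags|Ag]; last exact: AS.
by rewrite -[g](mulgK s); apply: AS => //; case: SS => _ _; apply.
Qed.

Lemma hat_open S A : is_subgroup S -> rstable S A -> open A -> open (hat S A).
Proof.
move=> SS AS oA; suff E : coset_proj S @^-1` hat S A = A.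
  by change (open (coset_proj S @^-1` hat S A)); rewrite E.
by apply/seteqP; split=> g; rewrite /preimage/= hat_proj.
Qed.

Lemma coset_proj_continuous S : continuous (@coset_proj R F S).
Proof. exact: pi_continuous. Qed.

Definition lcoset x P := [set g | P (x^-1 * g)%g].

Definition open_subgroup P := is_subgroup P /\ nbhs (1%g : G) P.

Lemma rstable_open P A : open_subgroup P -> rstable P A -> open A.
Proof.
move=> [[P1 _ _] nP] AP; rewrite openE => g Ag.
have : nbhs (g^-1 * g)%g P by rewrite mulVg.
by move=> /nbhs_mull; apply: filterS => h /= Ph; rewrite -[h](mulVKg g); exact: AP.
Qed.

Lemma rstableC P A : is_subgroup P -> rstable P A -> rstable P (~` A).
Proof.
move=> [_ _ PV] AP g s nA Ps Ags; apply: nA.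
by rewrite -[g](mulgK s); apply: AP => //; exact: PV.
Qed.

Lemma rstable_sub S P A : S `<=` P -> rstable P A -> rstable S A.
Proof. by move=> SP AP g s Ag /SP; exact: AP. Qed.

Lemma rstable_lcoset P x : is_subgroup P -> rstable P (lcoset x P).
Proof. by move=> [_ PM _] g s Pg Ps; rewrite /lcoset/= mulgA; exact: PM. Qed.

(** The cosets of such a P are the cells of all integrals below: in G/S they are
    open and compact, hence of finite positive volume, and there are countably
    many of them. *)
Definition good_subgroup S P :=
  [/\ open_subgroup P, S `<=` P & exists C, forall g, P g -> bdd C g].

Section Compactness.
Variables (S : set G).
Hypotheses (SS : is_subgroup S) (ZS : @group_center G `<=` S).

(** Every class of A has a representative in one compact subset of G. *)
Lemma compact_hat P A (C : R) : open_subgroup P -> S `<=` P -> rstable P A ->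
  (forall g, A g -> bdd C g) -> compact (hat S A).
Proof.
move=> oP SP AP Abd.
have [A0|/set0P[a Aa]] := eqVneq A set0.
  rewrite (_ : hat S A = set0); first exact: compact0.
  by rewrite A0; apply/seteqP; split=> q; case.
have C0 := bdd_gt0 (Abd a Aa).
have cA : compact (compact_part 1 C^-1 `&` A).
  apply: compact_closedI; first by apply: compact_compact_part; rewrite invr_gt0.
  rewrite -[A]setCK; apply: open_closedC.
  exact: rstable_open oP (rstableC oP.1 AP).
have AS := rstable_sub SP AP.
suff -> : hat S A = coset_proj S @` (compact_part 1 C^-1 `&` A).
  apply: continuous_compact cA; apply: continuous_subspaceT.
  exact: coset_proj_continuous.
apply/seteqP; split=> [q Aq|_ [g [_ Ag] <-]]; last exact/hat_proj.
have [b b0 bA] := bdd_scale (Abd _ Aq).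
have zb := scalar_GL2_center b0.
exists (scalar_GL2 b * coset_repr q)%g; rewrite zb.
  by split; [rewrite -zb | apply: AS => //; exact: ZS].
rewrite -[RHS]coset_reprK; apply/coset_projP => //.
rewrite invgM -mulgA mulVg mulg1; case: SS => _ _; apply; exact: ZS.
Qed.

(** Finitely many cosets of P cover A, and each of them is bounded. *)
Lemma hat_compact_bdd P A : good_subgroup S P -> rstable S A ->
  compact (hat S A) -> exists C : R, forall g, A g -> bdd C g.
Proof.
move=> [oP SP [D Pbd]] AS cA.
have PS x : rstable P (lcoset x P) by apply: rstable_lcoset; exact: oP.1.
have PS' x : rstable S (lcoset x P) by exact: rstable_sub (PS x).
have [||r _ rA] := @compact_seq_cover _ G _ setT (fun x => hat S (lcoset x P)) cA.
- by move=> x _; apply: hat_open => //; exact: rstable_open (PS x).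
- move=> q _; exists (coset_repr q) => //; rewrite /hat/= /lcoset/= mulVg.
  by case: oP => -[].
have [cst cstP] := choice (@bdd_exists R F).
exists (\sum_(x <- r) `|cst x * D|) => g Ag.
have /rA[x xr /(hat_proj _ SS (PS' x)) Pg] : hat S A (coset_proj S g).
  exact/hat_proj.
rewrite -[g](mulVKg x); apply: (bdd_le _ (bddM (cstP x) (Pbd _ Pg))).
rewrite (big_rem x)//= (le_trans (ler_norm _))// lerDl.
by apply: sumr_ge0 => i _; exact: normr_ge0.
Qed.

(** The support of f is open and closed, and right S-stable. *)
Lemma compact_modP P (f : G -> R[i]) : good_subgroup S P ->
  (forall g p, P p -> f (g * p)%g = f g) ->
  compact_mod S f <-> exists C : R, forall g, f g != 0 -> bdd C g.
Proof.
move=> gP fP; have [oP SP _] := gP.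
have AP : rstable P [set g | f g != 0] by move=> g s /= fg Ps; rewrite fP.
have AS := rstable_sub SP AP.
rewrite /compact_mod -(closure_id _).1; last first.
  rewrite -[X in closed X]setCK; apply: open_closedC.
  exact: rstable_open oP (rstableC oP.1 AP).
suff -> : coset_proj S @` [set g | f g != 0] = hat S [set g | f g != 0].
  split=> [|[C Cf]]; first exact: hat_compact_bdd gP AS.
  exact: compact_hat AP Cf.
apply/seteqP; split=> [_ [g Ag <-]|q Aq]; first exact/hat_proj.
by exists (coset_repr q) => //; exact: coset_reprK.
Qed.

(** The conjugates of a small ball by S all contain one smaller ball, since S
    is compact modulo the center; their intersection is normalized by S. *)
Lemma good_subgroup_exists (e : R) : 0 < e < 1 ->
  (exists C, forall s, S s -> bdd C s) ->
  exists2 P, good_subgroup S P & forall p, P p ->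
    exists s u, [/\ S s, ball1 e u & p = (s * u)%g].
Proof.
move=> /andP[e0 e1] [C SC]; have [S1 SM SV] := SS.
have [U1 UM UV] := @ball1_subgroup R F e (introT andP (conj (ltW e0) e1)).
pose U := [set u : G | forall s, S s -> ball1 e (s * u * s^-1)%g].
have Uconj s u : S s -> U u -> U (s * u * s^-1)%g.
  move=> Ss Uu s' Ss'.
  have -> : (s' * (s * u * s^-1) * s'^-1 = (s' * s) * u * (s' * s)^-1)%g.
    by rewrite invgM !mulgA.
  by apply: Uu; exact: SM.
have UMM u v : U u -> U v -> U (u * v)%g.
  move=> Uu Uv s Ss.
  have -> : (s * (u * v) * s^-1 = (s * u * s^-1) * (s * v * s^-1))%g.
    by rewrite !mulgA mulgVK.
  by apply: UM; [exact: Uu|exact: Uv].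
have UVV u : U u -> U (u^-1)%g.
  move=> Uu s Ss; have -> : (s * u^-1 * s^-1 = (s * u * s^-1)^-1)%g.
    by rewrite !invgM invgK mulgA.
  by apply: UV; exact: Uu.
have U1' : U 1%g by move=> s _; rewrite mulg1 mulgV.
have UB u : U u -> ball1 e u by move=> /(_ 1%g S1); rewrite mul1g invg1 mulg1.
have C0 : 0 < C := bdd_gt0 (SC _ S1).
pose P := [set g | exists s u, [/\ S s, U u & g = (s * u)%g]].
exists P; last by move=> _ [s [u [Ss /UB Uu ->]]]; exists s, u.
split; [split; first split | |].
- by exists 1%g, 1%g; rewrite mulg1.
- move=> _ _ [s1 [u1 [Ss1 Uu1 ->]]] [s2 [u2 [Ss2 Uu2 ->]]].
  exists (s1 * s2)%g, (s2^-1 * u1 * s2^-1^-1 * u2)%g; split; first exact: SM.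
    by apply: UMM => //; apply: Uconj => //; exact: SV.
  by rewrite invgK !mulgA mulgK.
- move=> _ [s [u [Ss Uu ->]]]; exists (s^-1)%g, (s * u^-1 * s^-1)%g.
  by split; [exact: SV | apply: Uconj => //; exact: UVV | rewrite invgM !mulgA mulVg mul1g].
- have /filterS := @ball1_nbhs1 R F (e / C) (divr_gt0 e0 C0); apply => u ub.
  exists 1%g, u; split=> // [s Ss|]; last by rewrite mul1g.
  by apply: bdd_conj_ball1 ub; exact: SC.
- by move=> s Ss; exists s, 1%g; rewrite mulg1.
- exists (C * 1) => _ [s [u [Ss /UB Uu ->]]]; apply: bddM; first exact: SC.
  exact: bdd_of_ball1 Uu.
Qed.

End Compactness.

(** G is a countable union of sets that are compact modulo the center. *)
Lemma coset_enum P : good_subgroup (@group_center G) P ->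
  exists x : nat -> G, forall g, exists i, P ((x i)^-1 * g)%g.
Proof.
move=> [oP ZP _].
have PS x : rstable P (lcoset x P) by apply: rstable_lcoset; exact: oP.1.
have /choice[D DP] n : exists D : seq G, forall g,
    compact_part 1 (n.+1%:R^-1 : R) g -> exists2 x, x \in D & lcoset x P g.
  have cn : compact (@compact_part R F 1 n.+1%:R^-1).
    by apply: compact_compact_part; rewrite invr_gt0 ltr0Sn.
  have [||D _ DP] := @compact_seq_cover _ G _ setT (fun x => lcoset x P) cn.
  - by move=> x _; exact: rstable_open (PS x).
  - by move=> q _; exists q => //; rewrite /lcoset/= mulVg; case: oP => -[].
  by exists D.
(* The k-th representative is the j-th one of the n-th set when k codes (n, j). *)
pose x k := if @unpickle (nat * nat)%type k is Some nj
  then nth (1%g : G) (D nj.1) nj.2 else 1%g.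
exists x => g; have [C gC] := @bdd_exists R F g.
have [a a0 aP] := bdd_scale (bdd_le (ltW (truncnS_gt C)) gC).
have [y /= yD Py] := DP _ _ aP.
exists (pickle (Num.truncn C, index y ((D (Num.truncn C))))).
rewrite /x pickleK nth_index//.
have := scalar_GL2_center a0; move: Py; rewrite /lcoset/= => Py za.
have [P1 PM PV] := oP.1.
have -> : (y^-1 * g = (y^-1 * (scalar_GL2 a * g)) * (scalar_GL2 a)^-1)%g.
  by rewrite za !mulgA mulgK.
by apply: PM => //; apply: PV; exact: ZP.
Qed.

End Cosets.
Arguments hat {R F} S A _.

(** * Integrals of locally constant functions *)
Lemma normc_ge0 (R : rcfType) (z : R[i]) : 0 <= Normc.normc z.
Proof. by case: z => a b; exact: sqrtr_ge0. Qed.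

Section Measure.
Variables (R : realType) (F : nonarchLocalFieldType R).
Local Notation G := (GL2 F).
Implicit Types (g h x : G) (A P : set G).

Section OneMeasure.
Variables (S : set G) (s : {measure set (coset_borel S) -> \bar R}).
Hypotheses (SS : is_subgroup S).

Definition vol A : \bar R := s (hat S A).

Lemma hat_measurable A : rstable S A -> open A ->
  measurable (hat S A : set (coset_borel S)).
Proof. by move=> AS oA; apply: sub_sigma_algebra; exact: hat_open. Qed.

Lemma vol0 : vol set0 = 0%E.
Proof. by rewrite /vol (_ : hat S set0 = set0) ?measure0. Qed.

Lemma hat_trivIset (B : nat -> set G) : trivIset setT B ->
  trivIset setT (fun i => hat S (B i)).
Proof.
move=> tB; apply/trivIsetP => i j _ _ ij; apply/seteqP; split=> q //= -[Bi Bj].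
have /trivIsetP /(_ i j I I ij) := tB.
by move=> /seteqP[/(_ (coset_repr q)) + _]; apply; split.
Qed.

Lemma vol_sum A (B : nat -> set G) : trivIset setT B ->
  (forall i, rstable S (B i)) -> (forall i, open (B i)) ->
  A = \bigcup_i B i -> vol A = (\sum_(i <oo) vol (B i))%E.
Proof.
move=> tB BS oB AB; rewrite /vol.
have -> : hat S A = \bigcup_i hat S (B i).
  by rewrite AB; apply/seteqP; split=> q [i _ Bi]; exists i.
rewrite measure_semi_bigcup//.
- by move=> i; exact: hat_measurable.
- exact: hat_trivIset.
- by apply: bigcupT_measurable => i; exact: hat_measurable.
Qed.

(** The integral of a function that is constant on the cells of a countable open
    partition is a series.  The cells need not be cosets, which allows the
    partition to be transported by translations and by inversion. *)
Lemma Lp_modP (B : nat -> set G) (f : G -> R[i]) (c : nat -> R) (p : R) :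
  0 < p -> trivIset setT B -> (forall g, exists i, B i g) ->
  (forall i, rstable S (B i)) -> (forall i, open (B i)) ->
  (forall i g, B i g -> Normc.normc (f g) `^ p = c i) ->
  (forall i g h, B i g -> B i h -> Normc.normc (f g) = Normc.normc (f h)) ->
  Lp_mod s p f <-> (\sum_(i <oo) (c i)%:E * vol (B i) < +oo)%E.
Proof.
move=> p0 tB cB BS oB fc fB.
have mf : measurable_fun setT (@coset_abs R F S f).
  move=> _ Y mY; rewrite setTI.
  rewrite (_ : _ @^-1` Y = hat S [set g | Y (Normc.normc (f g))])//.
  apply: hat_measurable => [g x /= fg Sx|].
    have [i Bi] := cB g; rewrite -(fB i g)//; exact: BS.
  rewrite openE => g /= fg; have [i Bi] := cB g.
  have := oB i; rewrite openE => /(_ g Bi); apply: filterS => h Bh.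
  by rewrite /= -(fB i g).
have mfp : measurable_fun setT ((@powR R ^~ p) \o @coset_abs R F S f).
  by apply: (@measurableT_comp _ _ _ _ _ _ (@powR R ^~ p)) => //.
have Lint : Lp_mod s p f <-> (\int[s]_q ((coset_abs f q) `^ p)%:E < +oo)%E.
  have E : 'N[s]_p%:E[EFin \o coset_abs f]%E =
      ((\int[s]_q ((coset_abs f q) `^ p)%:E) `^ p^-1)%E.
    rewrite unlock /Lnorm; congr (_ `^ _)%E; apply: eq_integral => q _.
    by rewrite /= ger0_norm ?normc_ge0.
  rewrite /Lp_mod; split=> [/andP[_]|fin].
    rewrite inE/= /finite_norm E => /lty_poweRy; apply.
    by rewrite gt_eqF// invr_gt0.
  apply/andP; split; first by rewrite inE.
  by rewrite inE/= /finite_norm E poweR_lty.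
suff <- : (\int[s]_q ((coset_abs f q) `^ p)%:E =
    \sum_(i <oo) (c i)%:E * vol (B i))%E by [].
have UB : \bigcup_i hat S (B i) = [set: coset_borel S].
  by apply/seteqP; split=> // q _; have [i Bi] := cB (coset_repr q); exists i.
rewrite -UB ge0_integral_bigcup//.
- apply: eq_eseriesr => i _.
  rewrite -(integral_cst _ (hat_measurable (BS i) (oB i))).
  apply: eq_integral => q /set_mem Bq; congr (_%:E); exact: (fc i).
- by move=> i; exact: hat_measurable.
- by rewrite UB; apply/measurable_EFinP.
- by move=> q _; rewrite lee_fin powR_ge0.
- exact: hat_trivIset.
Qed.

Hypotheses (ZS : @group_center G `<=` S) (s_inv : invariant_measure s).

Lemma vol_lcoset x A : rstable S A -> open A -> vol (lcoset x A) = vol A.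
Proof.
move=> AS oA; have [_ _ inv] := s_inv.
rewrite /vol -(inv (x^-1)%g (hat S A)); last exact: hat_measurable.
congr (s _); apply/seteqP; split=> q; rewrite /preimage/= /coset_act => Aq.
  by apply/(hat_proj _ SS AS).
by move/(hat_proj _ SS AS) : Aq.
Qed.

Lemma vol_fin P : good_subgroup S P -> (vol P < +oo)%E.
Proof.
move=> [oP SP [C PC]]; have [_ fin _] := s_inv; apply: fin.
apply: (compact_hat SS ZS oP SP _ PC).
by move=> g p Pg; case: oP => -[_ PM _] _; exact: PM.
Qed.

End OneMeasure.

(** The cosets of P, indexed by their first occurrence in the enumeration x:
    [pieces x P i] is empty when the coset of [x i] has occurred before. *)
Definition pieces (x : nat -> G) P i :=
  [set g | P ((x i)^-1 * g)%g /\ forall j, (j < i)%N -> ~ P ((x j)^-1 * g)%g].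

Section Pieces.
Variables (P : set G) (x : nat -> G).
Hypothesis PP : is_subgroup P.

Lemma pieces_trivIset : trivIset setT (pieces x P).
Proof.
apply/trivIsetP => i j _ _; wlog ij : i j / (i < j)%N.
  move=> H nij; have := nij; rewrite neq_ltn => /orP[ij|ji]; first exact: H.
  by rewrite setIC; apply: H => //; rewrite eq_sym.
by move=> _; apply/seteqP; split=> // g [[Pi _] [_ /(_ i ij)]].
Qed.

Lemma pieces_cover g : (exists i, P ((x i)^-1 * g)%g) -> exists i, pieces x P i g.
Proof.
move=> ex; pose Q i := `[< P ((x i)^-1 * g)%g >].
have exQ : exists i, Q i by have [i Pi] := ex; exists i; exact/asboolP.
case: (ex_minnP exQ) => i /asboolP Pi mini; exists i; split=> // j ji Pj.
by have := mini j (asboolT Pj); rewrite leqNgt ji.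
Qed.

Lemma pieces_rstable i : rstable P (pieces x P i).
Proof.
have PL y := @rstable_lcoset R F P y PP.
move=> g p [Pi nP] Pp; split=> [|j ji]; first exact: (PL (x i)).
exact: (rstableC PP (PL (x j)) (nP j ji) Pp).
Qed.

Lemma pieces_lcoset i : pieces x P i !=set0 -> pieces x P i = lcoset (x i) P.
Proof.
move=> [g [Pi nP]]; apply/seteqP; split=> [h []//|h Ph].
have [_ PM PV] := PP.
have -> : h = (g * ((((x i)^-1 * g)^-1) * ((x i)^-1 * h)))%g.
  by rewrite invgM invgK !mulgA mulgV mul1g mulgV mul1g.
by apply: pieces_rstable => //; apply: PM => //; exact: PV.
Qed.

End Pieces.

Lemma good_subgroup_center S P : @group_center G `<=` S -> good_subgroup S P ->
  good_subgroup (@group_center G) P.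
Proof. by move=> ZS [oP SP bP]; split=> // z /ZS /SP. Qed.

Section PiecesVolume.
Variables (S : set G) (s : {measure set (coset_borel S) -> \bar R}).
Hypotheses (SS : is_subgroup S) (ZS : @group_center G `<=` S).
Hypothesis s_inv : invariant_measure s.
Variables (P : set G) (gP : good_subgroup S P) (x : nat -> G).
Local Notation B := (pieces x P).

Let PP : is_subgroup P. Proof. by case: gP => -[]. Qed.

Lemma pieces_rstableS i : rstable S (B i).
Proof. by case: gP => _ SP _ g u Bg /SP; exact: pieces_rstable. Qed.

Lemma pieces_open i : open (B i).
Proof.
case: gP => oP _ _; apply: (rstable_open oP) => g u; exact: pieces_rstable.
Qed.

Lemma good_subgroup_rstable : rstable S P.
Proof. by case: gP => _ SP _ g p Pg /SP Pp; case: PP => _ PM _; exact: PM. Qed.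

Lemma good_subgroup_open : open P.
Proof.
apply: (@rstable_open _ _ P); first by case: gP.
by move=> g p Pg Pp; case: PP => _ PM _; exact: PM.
Qed.

Lemma vol_pieces i : B i !=set0 -> vol s (B i) = vol s P.
Proof.
move=> /(pieces_lcoset PP) ->; apply: vol_lcoset => //.
  exact: good_subgroup_rstable.
exact: good_subgroup_open.
Qed.

(** Countably many translates of P cover G, so P cannot have volume 0. *)
Lemma vol_gt0 : (forall g, exists i, P ((x i)^-1 * g)%g) -> (0 < vol s P)%E.
Proof.
move=> xP; rewrite lt0e measure_ge0 andbT; apply/eqP => v0.
have [/eqP + _ _] := s_inv; apply.
have E : setT = \bigcup_i B i.
  by apply/seteqP; split=> // g _; have [i Bi] := pieces_cover (xP g); exists i.
rewrite -[LHS]/(vol s setT).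
rewrite (@vol_sum _ s SS _ _ (@pieces_trivIset P x) pieces_rstableS pieces_open E).
rewrite eseries0// => i _ _.
have [->|/set0P Bi] := eqVneq (B i) set0; first exact: vol0.
by rewrite vol_pieces.
Qed.

End PiecesVolume.

Lemma vol_good_gt0 S (s : {measure set (coset_borel S) -> \bar R}) P :
  is_subgroup S -> @group_center G `<=` S -> invariant_measure s ->
  good_subgroup S P -> (0 < vol s P)%E.
Proof.
move=> SS ZS sI gP; have [x xP] := coset_enum (good_subgroup_center ZS gP).
exact: vol_gt0 xP.
Qed.

Lemma vol_fine S (s : {measure set (coset_borel S) -> \bar R}) P :
  is_subgroup S -> @group_center G `<=` S -> invariant_measure s ->
  good_subgroup S P -> exists2 v : R, 0 < v & vol s P = v%:E.
Proof.
move=> SS ZS sI gP; have v0 := vol_good_gt0 SS ZS sI gP.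
have vf := vol_fin SS ZS sI gP.
exists (fine (vol s P)); first by rewrite fine_gt0// v0.
by rewrite fineK// ge0_fin_numE// ltW.
Qed.

Lemma eseries_compare (c : nat -> R) (u v : nat -> \bar R) (C : R) :
  (forall i, 0 <= c i) -> (forall i, 0 <= u i)%E -> (forall i, 0 <= v i)%E ->
  (forall i, v i <= C%:E * u i)%E ->
  (\sum_(i <oo) (c i)%:E * u i < +oo)%E -> (\sum_(i <oo) (c i)%:E * v i < +oo)%E.
Proof.
move=> c0 u0 v0 vu fin.
apply: (@le_lt_trans _ _ (\sum_(i <oo) C%:E * ((c i)%:E * u i))%E).
  apply: lee_nneseries => i *; first by rewrite mule_ge0// lee_fin.
  by rewrite muleCA lee_wpmul2l// lee_fin.
rewrite nneseriesZl => [|i _]; last by rewrite mule_ge0// lee_fin.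
have f0 : (0 <= \sum_(i <oo) (c i)%:E * u i)%E.
  by apply: nneseries_ge0 => i *; rewrite mule_ge0// lee_fin.
have : (\sum_(i <oo) (c i)%:E * u i)%E \is a fin_num by rewrite ge0_fin_numE.
by move=> /fineK <-; rewrite -EFinM ltry.
Qed.

Definition rinvariant P (f : G -> R[i]) := forall g u, P u -> f (g * u)%g = f g.

Section Compare.
Variables (P : set G) (f : G -> R[i]) (p : R).
Hypotheses (fP : rinvariant P f) (p0 : 0 < p).

Lemma const_on_pieces (x : nat -> G) i g : pieces x P i g -> f g = f (x i).
Proof. by move=> [Pi _]; rewrite -(fP (x i) Pi) mulVKg. Qed.

Lemma Lp_mod_series S (s : {measure set (coset_borel S) -> \bar R})
    (x : nat -> G) : is_subgroup S -> good_subgroup S P ->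
  (forall g, exists i, P ((x i)^-1 * g)%g) ->
  Lp_mod s p f <->
  (\sum_(i <oo) (Normc.normc (f (x i)) `^ p)%:E * vol s (pieces x P i) < +oo)%E.
Proof.
move=> SS gP xP; apply: Lp_modP => //.
- exact: pieces_trivIset.
- by move=> g; exact: pieces_cover.
- exact: (pieces_rstableS gP).
- exact: (pieces_open gP).
- by move=> i g /const_on_pieces ->.
- by move=> i g h /const_on_pieces -> /const_on_pieces ->.
Qed.

(** Both integrals are sums over the cosets of P, on which f is constant, and
    each measure gives the same volume to all these cosets. *)
Lemma Lp_mod_change S1 S2 (s1 : {measure set (coset_borel S1) -> \bar R})
    (s2 : {measure set (coset_borel S2) -> \bar R}) :
  is_subgroup S1 -> is_subgroup S2 ->
  @group_center G `<=` S1 -> @group_center G `<=` S2 ->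
  invariant_measure s1 -> invariant_measure s2 ->
  good_subgroup S1 P -> good_subgroup S2 P ->
  Lp_mod s1 p f -> Lp_mod s2 p f.
Proof.
move=> SS1 SS2 ZS1 ZS2 I1 I2 g1 g2.
have [x xP] := coset_enum (good_subgroup_center ZS1 g1).
have [v1 v10 v1E] := vol_fine SS1 ZS1 I1 g1.
have [v2 v20 v2E] := vol_fine SS2 ZS2 I2 g2.
move/(Lp_mod_series s1 SS1 g1 xP) => fin; apply/(Lp_mod_series s2 SS2 g2 xP).
apply: (eseries_compare (C := v2 / v1)) fin => i; rewrite ?measure_ge0 ?powR_ge0//.
have [->|/set0P Bi] := eqVneq (pieces x P i) set0; first by rewrite !vol0 mule0.
by rewrite !vol_pieces// v1E v2E -EFinM divfK ?gt_eqF.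
Qed.

Lemma Lp_mod_translate S (s : {measure set (coset_borel S) -> \bar R}) y :
  is_subgroup S -> @group_center G `<=` S -> invariant_measure s ->
  good_subgroup S P -> Lp_mod s p f -> Lp_mod s p (fun g => f (y * g)%g).
Proof.
move=> SS ZS sI gP; have PP : is_subgroup P by case: gP => -[].
have [x xP] := coset_enum (good_subgroup_center ZS gP).
have cov g : exists i, pieces x P i g by exact: pieces_cover.
have tB := @pieces_trivIset P x.
have Bs := @pieces_rstableS _ _ gP x.
have Bo := @pieces_open _ _ gP x.
move/(Lp_mod_series s SS gP xP) => fin.
pose c i := Normc.normc (f (x i)) `^ p.
pose B' i := lcoset y^-1%g (pieces x P i).
apply/(Lp_modP (B := B') (c := c) s SS p0).
- apply/trivIsetP => i j _ _ ij; apply/seteqP; split=> // g [].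
  rewrite /B' /lcoset/= => Bi Bj; have /trivIsetP /(_ i j I I ij) := tB.
  by move=> /seteqP[/(_ (y^-1^-1 * g)%g) + _]; apply; split.
- by move=> g; have [i Bi] := cov (y * g)%g; exists i; rewrite /B' /lcoset/= invgK.
- by move=> i g u; rewrite /B' /lcoset/= mulgA; exact: Bs.
- move=> i; apply: (@rstable_open _ _ P); first by case: gP.
  by move=> g u; rewrite /B' /lcoset/= mulgA; exact: pieces_rstable.
- by move=> i g; rewrite /B' /lcoset/= invgK => /const_on_pieces ->.
- by move=> i g h; rewrite /B' /lcoset/= invgK => /const_on_pieces -> /const_on_pieces ->.
rewrite (eq_eseriesr (g := fun i => ((c i)%:E * vol s (pieces x P i))%E)) //.
by move=> i _; rewrite /B' vol_lcoset.
Qed.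

End Compare.

End Measure.

(** * Unimodularity *)
Section AdjugateConjugate.
Variable F : fieldType.

(** If s conjugates x to its adjugate, then the product below is the scalar
    det x.  A suitable s is found among the matrices of trace 0. *)
Lemma GL2_conj_adj (x : GL2 F) :
  exists s : GL2 F, group_center (s * x * s^-1 * x)%g.
Proof.
pose A := mx22 (x 1 1) (- x 0 1) (- x 1 0) (x 0 0).
suff [M M0 Mx] : exists2 M : 'M[F]_2, \det M != 0 & M *m x = A *m M.
  exists (GL2_of M).
  have dA : \det A != 0.
    have := GL2_det x; rewrite !det22 !mxE/= mulrNN.
    by rewrite [x 1 1 * _]mulrC.
  have -> : (GL2_of M * x * (GL2_of M)^-1 = GL2_of A)%g.
    apply: (can_inj (mulgK (GL2_of M))); rewrite mulgVK; apply: GL2_eq.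
    by rewrite !GL2_valM !GL2_ofE.
  by apply/GL2_centerP; rewrite !GL2_mul_entry !GL2_ofE// !mxE/=; split; ring.
have [x10|x10] := eqVneq (x 1 0) 0; last first.
  exists (mx22 (x 1 0) (x 1 1 - x 0 0) 0 (- x 1 0)).
    by rewrite det22 !mxE/= mulr0 subr0 mulrN oppr_eq0 mulf_neq0.
  by apply: eq_mx22; rewrite !mulmx22 !mxE/=; ring.
have [x01|x01] := eqVneq (x 0 1) 0; last first.
  exists (mx22 (x 0 1) 0 (x 1 1 - x 0 0) (- x 0 1)).
    by rewrite det22 !mxE/= mul0r subr0 mulrN oppr_eq0 mulf_neq0.
  by apply: eq_mx22; rewrite !mulmx22 !mxE/=; ring.
exists (mx22 0 1 1 0).
  by rewrite det22 !mxE/= mul0r mulr1 sub0r oppr_eq0 oner_eq0.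
by apply: eq_mx22; rewrite !mulmx22 !mxE/= ?x10 ?x01; ring.
Qed.

End AdjugateConjugate.

Section Unimodular.
Variables (R : realType) (F : nonarchLocalFieldType R).
Local Notation G := (GL2 F).
Local Notation Z := (@group_center G).
Implicit Types (g h x y : G) (A P W : set G).
Variable (m : {measure set (coset_borel Z) -> \bar R}).
Hypothesis m_inv : invariant_measure m.

Lemma center_subgroup : is_subgroup Z.
Proof.
split=> [g|g h gC hC k|g gC k]; first by rewrite mul1g mulg1.
  by rewrite -mulgA hC mulgA gC mulgA.
by rewrite -{1}[k](mulgK g) -(gC k) !mulgA mulVg mul1g.
Qed.

Definition conjs x P := [set h | P (x^-1 * h * x)%g].

Lemma conjsM x y P : conjs (x * y)%g P = conjs x (conjs y P).
Proof. by apply/seteqP; split=> h; rewrite /conjs/= invgM !mulgA. Qed.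

Lemma conjs_center z P : Z z -> conjs z P = P.
Proof.
move=> zC; have E h : (z^-1 * h * z = h)%g by rewrite -mulgA -zC mulKg.
by apply/seteqP; split=> h; rewrite /conjs/= E.
Qed.

Lemma good_subgroup_conjs x P : good_subgroup Z P -> good_subgroup Z (conjs x P).
Proof.
move=> [[[P1 PM PV] nP] ZP [C PC]]; split; [split; first split | |].
- by rewrite /conjs/= mulg1 mulVg.
- move=> g h Pg Ph; rewrite /conjs/=.
  have -> : (x^-1 * (g * h) * x = (x^-1 * g * x) * (x^-1 * h * x))%g.
    by rewrite !mulgA mulgK.
  exact: PM.
- move=> g Pg; rewrite /conjs/=.
  have -> : (x^-1 * g^-1 * x = (x^-1 * g * x)^-1)%g by rewrite !invgM invgK mulgA.
  exact: PV.
- have : nbhs (1 * x)%g [set h | P (x^-1 * h)%g].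
    by apply: nbhs_mull; rewrite mul1g mulVg.
  by move=> /nbhs_mulr; apply: filterS => h; rewrite /conjs/= mulgA.
- by move=> z zC; rewrite /conjs/= -mulgA zC mulKg; exact: ZP.
- have [D xD] := @bdd_exists R F x; exists (D * C * D) => g Pg.
  have -> : g = (x * (x^-1 * g * x) * x^-1)%g by rewrite !mulgA mulgV mul1g mulgK.
  by apply: bddM (bddV xD); apply: bddM => //; exact: PC.
Qed.

Lemma good_subgroupI P W : good_subgroup Z P -> good_subgroup Z W ->
  good_subgroup Z (P `&` W).
Proof.
move=> [[[P1 PM PV] nP] ZP [C PC]] [[[W1 WM WV] nW] ZW _]; split.
- split; last exact: filterI.
  by split=> [//|g h [? ?] [? ?]|g [? ?]]; split; auto.
- by move=> z zC; split; [exact: ZP|exact: ZW].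
- by exists C => g [/PC].
Qed.

(** Both P and its conjugate are disjoint unions of equally many cosets of W
    and of the conjugate of W. *)
Lemma vol_conjs_ratio x P W : good_subgroup Z P -> good_subgroup Z W ->
  W `<=` P -> (vol m (conjs x P) * vol m W = vol m P * vol m (conjs x W))%E.
Proof.
move=> gP gW WP; have SS := center_subgroup.
have ZZ : Z `<=` Z by [].
have [y yP] := coset_enum gW.
have WW : is_subgroup W by case: gW => -[].
have PP : is_subgroup P by case: gP => -[].
have oW : open_subgroup W by case: gW.
pose B i := pieces y W i `&` P.
pose chi i : \bar R := if B i == set0 then 0%E else 1%E.
have chi0 i : (0 <= chi i)%E by rewrite /chi; case: ifP.
have tB : trivIset setT B by apply: trivIset_setIr; exact: pieces_trivIset.
have BW i : rstable W (B i).
  move=> g w [Bg Pg] Ww; split; first exact: pieces_rstable.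
  by case: PP => _ PM _; apply: PM => //; exact: WP.
have Bl i : B i !=set0 -> B i = lcoset (y i) W.
  move=> [g [Bg Pg]]; have E := pieces_lcoset WW (ex_intro _ g Bg).
  rewrite /B E; apply/seteqP; split=> [h []//|h Wh]; split=> //.
  have [_ PM PV] := PP; have [_ WM WV] := WW; rewrite E in Bg.
  have -> : h = (g * (((y i)^-1 * g)^-1 * ((y i)^-1 * h)))%g.
    by rewrite invgM invgK !mulgA mulgV mul1g mulgV mul1g.
  by apply: PM => //; apply: WP; apply: WM => //; exact: WV.
have goodW u : rstable Z (conjs u W) /\ open (conjs u W).
  have gu := good_subgroup_conjs u gW.
  by split; [exact: (good_subgroup_rstable gu)|exact: (good_subgroup_open gu)].
have volsum u : vol m (conjs u P) = (\sum_(i <oo) vol m (conjs u W) * chi i)%E.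
  have Bconj i : B i !=set0 ->
      conjs u (B i) = lcoset (u * y i * u^-1)%g (conjs u W).
    move=> /Bl ->; apply/seteqP; split=> h; rewrite /conjs /lcoset/=;
    by rewrite !invgM invgK !mulgA mulVg mul1g.
  rewrite (@vol_sum _ _ _ m SS _ (fun i => conjs u (B i))).
  - apply: eq_eseriesr => i _; rewrite /chi; case: eqP => [->|/eqP/set0P Bi].
      by rewrite mule0 (_ : conjs u set0 = set0) ?vol0//.
    by rewrite mule1 Bconj// vol_lcoset//; have [] := goodW u.
  - apply/trivIsetP => i j _ _ ij; apply/seteqP; split=> // h [] Bi Bj.
    have /trivIsetP /(_ i j I I ij) := tB.
    by move=> /seteqP[/(_ (u^-1 * h * u)%g) + _]; apply; split.
  - move=> i g z Bg zC; rewrite /conjs/=.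
    have -> : (u^-1 * (g * z) * u = (u^-1 * g * u) * z)%g.
      by rewrite -!mulgA (zC u) .
    by apply: BW => //; case: gW => _ ZW _; exact: ZW.
  - move=> i; have [B0|/set0P Bi] := eqVneq (B i) set0.
      by rewrite B0 (_ : conjs u set0 = set0) //; exact: open0.
    rewrite Bconj//; apply: (@rstable_open _ _ (conjs u W)).
      by have [] := good_subgroup_conjs u gW.
    by apply: rstable_lcoset; have [[]] := good_subgroup_conjs u gW.
  - apply/seteqP; split=> h; last by move=> [i _ []].
    move=> Ph; have [i Bi] := pieces_cover (yP (u^-1 * h * u)%g).
    by exists i => //; split.
have vP u : vol m (conjs u P) = (vol m (conjs u W) * \sum_(i <oo) chi i)%E.
  have [v v0 vE] := vol_fine SS ZZ m_inv (good_subgroup_conjs u gW).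
  by rewrite volsum vE -nneseriesZl.
have E1 Q : conjs 1%g Q = Q by apply: conjs_center; case: SS.
have := vP 1%g; rewrite !E1 => ->; rewrite vP.
by rewrite [LHS]muleC muleA [RHS]muleAC.
Qed.

(** By [vol_conjs_ratio] the factor D by which conjugation changes volumes does
    not depend on the subgroup, so it is a character; it is trivial on the
    center, and D x is its own inverse by [GL2_conj_adj]. *)
Lemma unimodular x P : good_subgroup Z P -> vol m (conjs x P) = vol m P.
Proof.
move=> gP; have SS := center_subgroup; have ZZ : Z `<=` Z by [].
pose v Q := fine (vol m Q).
have vE Q : good_subgroup Z Q -> 0 < v Q /\ vol m Q = (v Q)%:E.
  by move=> /(vol_fine SS ZZ m_inv)[r r0 rE]; rewrite /v rE.
have ratio u Q W : good_subgroup Z Q -> good_subgroup Z W -> W `<=` Q ->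
    v (conjs u Q) / v Q = v (conjs u W) / v W.
  move=> gQ gW WQ; have := vol_conjs_ratio u gQ gW WQ.
  have [vQ ->] := vE _ gQ; have [vW ->] := vE _ gW.
  have [vQ' ->] := vE _ (good_subgroup_conjs u gQ).
  have [vW' ->] := vE _ (good_subgroup_conjs u gW).
  rewrite -!EFinM => -[E]; apply/eqP.
  have nQ : v Q != 0 by rewrite gt_eqF.
  have nW : v W != 0 by rewrite gt_eqF.
  by rewrite eqr_div// E mulrC.
pose D u := v (conjs u P) / v P.
have DE u Q : good_subgroup Z Q -> v (conjs u Q) = D u * v Q.
  move=> gQ; have gI := good_subgroupI gP gQ; have [vQ _] := vE _ gQ.
  have IP : P `&` Q `<=` P by move=> ? [].
  have IQ : P `&` Q `<=` Q by move=> ? [].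
  have -> : D u = v (conjs u Q) / v Q.
    by rewrite /D (ratio u _ _ gP gI IP) (ratio u _ _ gQ gI IQ).
  by rewrite divfK// gt_eqF.
have DM a b : D (a * b)%g = D a * D b.
  have [vP _] := vE _ gP.
  rewrite {1}/D conjsM DE; last exact: good_subgroup_conjs.
  by rewrite DE// mulrA mulfK ?gt_eqF.
have DZ z : Z z -> D z = 1.
  by move=> zC; rewrite /D conjs_center// divff// gt_eqF// (vE _ gP).1.
have D0 u : 0 < D u.
  by apply: divr_gt0; [exact: (vE _ (good_subgroup_conjs u gP)).1|exact: (vE _ gP).1].
have Dx : D x = 1.
  have [s /DZ] := GL2_conj_adj x; rewrite !DM => E.
  have Ds : D s * D (s^-1)%g = 1 by rewrite -DM mulgV DZ//; case: SS.
  have /eqP : D x ^+ 2 = 1 by rewrite -[RHS]E -[LHS]mul1r -Ds; ring.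
  by rewrite sqrp_eq1 ?ltW// => /eqP.
have [_ ->] := vE _ (good_subgroup_conjs x gP); have [_ ->] := vE _ gP.
by rewrite DE// Dx mul1r.
Qed.

(** Inversion turns left cosets into right cosets, which are left cosets of
    conjugate subgroups. *)
Lemma Lp_mod_inv P (f : G -> R[i]) (p : R) : good_subgroup Z P ->
  rinvariant P f -> 0 < p ->
  Lp_mod m p f <-> Lp_mod m p (fun g => f (g^-1)%g).
Proof.
move=> gP fP p0; have SS := center_subgroup; have ZZ : Z `<=` Z by [].
have PP : is_subgroup P by case: gP => -[].
have [x xP] := coset_enum gP.
pose c i := Normc.normc (f (x i)) `^ p.
have cov g : exists i, pieces x P i g by exact: pieces_cover.
have tB := @pieces_trivIset R F P x.
have Bs := @pieces_rstableS _ _ _ _ gP x.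
have Bo := @pieces_open _ _ _ _ gP x.
have H1 := Lp_mod_series fP p0 m SS gP xP.
pose B' i := [set g | pieces x P i (g^-1)%g].
have B'E i : pieces x P i !=set0 ->
    B' i = lcoset (x i)^-1%g (conjs (x i) P).
  move=> /(pieces_lcoset PP) E; rewrite /B' E.
  have [_ _ PV] := PP.
  apply/seteqP; split=> g; rewrite /lcoset /conjs/= invgK !mulgA mulVg mul1g => Pg.
    by rewrite -[(g * _)%g]invgK; apply: PV; rewrite invgM.
  by rewrite -invgM; exact: PV.
have B0 i : pieces x P i = set0 -> B' i = set0 by rewrite /B' => ->.
have H2 : Lp_mod m p (fun g => f (g^-1)%g) <->
    (\sum_(i <oo) (c i)%:E * vol m (B' i) < +oo)%E.
  apply: Lp_modP => //.
  - apply/trivIsetP => i j _ _ ij; apply/seteqP; split=> // g [].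
    rewrite /B'/= => Bi Bj; have /trivIsetP /(_ i j I I ij) := tB.
    by move=> /seteqP[/(_ (g^-1)%g) + _]; apply; split.
  - by move=> g; have [i Bi] := cov (g^-1)%g; exists i.
  - move=> i g z Bg zC; rewrite /B'/= invgM.
    have zV : Z (z^-1)%g by case: SS => _ _; apply.
    by rewrite zV; exact: Bs.
  - move=> i; have [/B0 ->|/set0P/B'E ->] := eqVneq (pieces x P i) set0.
      exact: open0.
    apply: (@rstable_open _ _ (conjs (x i) P)).
      by have [] := good_subgroup_conjs (x i) gP.
    by apply: rstable_lcoset; have [[]] := good_subgroup_conjs (x i) gP.
  - by move=> i g Bg; rewrite (const_on_pieces fP Bg).
  - by move=> i g h Bg Bh; rewrite (const_on_pieces fP Bg) (const_on_pieces fP Bh).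
suff E i : vol m (B' i) = vol m (pieces x P i).
  have SE : (\sum_(i <oo) (c i)%:E * vol m (B' i) =
      \sum_(i <oo) (c i)%:E * vol m (pieces x P i))%E.
    by apply: eq_eseriesr => i _; rewrite E.
  by rewrite SE in H2; split=> [/H1/H2|/H2/H1].
have [Bi|/set0P Bi] := eqVneq (pieces x P i) set0; first by rewrite B0 ?Bi.
rewrite B'E// vol_pieces// vol_lcoset//; last 2 first.
- exact: (good_subgroup_rstable (good_subgroup_conjs _ gP)).
- exact: (good_subgroup_open (good_subgroup_conjs _ gP)).
exact: unimodular.
Qed.

End Unimodular.

(** * Stability of integrability under combinations *)
Section Combinations.
Variables (R : realType) (F : nonarchLocalFieldType R).
Local Notation G := (GL2 F).
Variables (S P : set G) (s : {measure set (coset_borel S) -> \bar R}) (p : R).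
Hypotheses (SS : is_subgroup S) (ZS : @group_center G `<=` S).
Hypotheses (s_inv : invariant_measure s) (gP : good_subgroup S P) (p0 : 0 < p).
Local Notation normc := Normc.normc.
Implicit Types (f h : G -> R[i]).

Lemma powRD_le (a b : R) : 0 <= a -> 0 <= b ->
  (a + b) `^ p <= 2 `^ p * (a `^ p + b `^ p).
Proof.
move=> a0 b0; have mono (x y : R) : 0 <= x -> x <= y -> x `^ p <= y `^ p.
  by move=> x0 xy; apply: ge0_ler_powR; rewrite ?nnegrE ?(ltW p0) ?(le_trans x0).
have [ab|/ltW ba] := leP a b.
  apply: (le_trans (mono _ (2 * b) (addr_ge0 a0 b0) _)); first lra.
  by rewrite powRM// ler_wpM2l ?powR_ge0// lerDr powR_ge0.
apply: (le_trans (mono _ (2 * a) (addr_ge0 a0 b0) _)); first lra.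
by rewrite powRM// ler_wpM2l ?powR_ge0// lerDl powR_ge0.
Qed.

Lemma Lp_mod_linear (a : R[i]) f h : rinvariant P f -> rinvariant P h ->
  Lp_mod s p f -> Lp_mod s p h -> Lp_mod s p (fun g => a * f g + h g).
Proof.
move=> fP hP; have [x xP] := coset_enum (good_subgroup_center ZS gP).
have fhP : rinvariant P (fun g => a * f g + h g) by move=> g u Pu; rewrite fP// hP.
move=> /(Lp_mod_series fP p0 s SS gP xP) Lf /(Lp_mod_series hP p0 s SS gP xP) Lh.
apply/(Lp_mod_series fhP p0 s SS gP xP).
set v := fun i => vol s (pieces x P i) in Lf Lh *.
have v0 i : (0 <= v i)%E by exact: measure_ge0.
pose c i := 2 `^ p * normc a `^ p * normc (f (x i)) `^ p.
pose d i := 2 `^ p * normc (h (x i)) `^ p.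
apply: (@le_lt_trans _ _ (\sum_(i <oo) ((c i)%:E * v i + (d i)%:E * v i))%E).
  apply: lee_nneseries => i *; first by rewrite mule_ge0// lee_fin powR_ge0.
  rewrite -ge0_muleDl ?lee_fin ?mulr_ge0 ?powR_ge0// -EFinD lee_wpmul2r//.
  rewrite lee_fin /c /d -mulrA -mulrDr -powRM ?normc_ge0// -Normc.normcM.
  apply: le_trans (powRD_le (normc_ge0 _) (normc_ge0 _)).
  apply: ge0_ler_powR; rewrite ?nnegrE ?(ltW p0) ?addr_ge0 ?normc_ge0//.
  exact: le_normcD.
have series (k : R) (w : nat -> R) : 0 <= k -> (forall i, 0 <= w i) ->
   (\sum_(i <oo) (w i)%:E * v i < +oo)%E ->
   (\sum_(i <oo) (k * w i)%:E * v i < +oo)%E.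
  move=> k0 w0 Lw.
  have := @eseries_compare R w v (fun i => k%:E * v i)%E k w0 v0.
  have kv0 i : (0 <= k%:E * v i)%E by rewrite mule_ge0.
  move=> /(_ kv0 (fun i => lexx _) Lw).
  by under eq_eseriesr do rewrite muleA -EFinM [w _ * k]mulrC.
rewrite nneseriesD; last 2 first.
- by move=> i *; rewrite mule_ge0// lee_fin /c !mulr_ge0 ?powR_ge0.
- by move=> i *; rewrite mule_ge0// lee_fin /d !mulr_ge0 ?powR_ge0.
rewrite lte_add_pinfty//; apply: series => //; rewrite ?mulr_ge0 ?powR_ge0//;
  by move=> i; exact: powR_ge0.
Qed.

Lemma Lp_mod_combination (r : seq (R[i] * G)) f : rinvariant P f ->
  Lp_mod s p f -> Lp_mod s p (fun g => \sum_(q <- r) q.1 * f (q.2 * g)%g).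
Proof.
move=> fP Lf; elim: r => [|q r IH].
  have [x xP] := coset_enum (good_subgroup_center ZS gP).
  have zP : rinvariant P (fun g => \sum_(q <- [::]) q.1 * f (q.2 * g)%g).
    by move=> g u _; rewrite !big_nil.
  apply/(Lp_mod_series zP p0 s SS gP xP); rewrite eseries0 ?ltry// => i _ _.
  by rewrite big_nil Normc.normc0 powR0 ?mul0e// gt_eqF.
under [X in Lp_mod s p X]funext do rewrite big_cons.
apply: (@Lp_mod_linear q.1 (fun g => f (q.2 * g)%g)) => //.
- by move=> g u Pu; rewrite mulgA; exact: fP.
- by move=> g u Pu; apply: eq_bigr => q1 _; rewrite mulgA (fP _ u)//.
- exact: (Lp_mod_translate fP p0 q.2 SS ZS s_inv gP Lf).
Qed.

End Combinations.

(** * Smooth linear forms *)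
Section RowSpan.
Variables (K : fieldType) (n : nat).

(** S is the row space of a matrix of maximal rank among those whose rows are in
    S, and a vector outside a row space is detected by the cokernel. *)
Lemma row_span_dichotomy (S : set 'rV[K]_n) (u : 'rV[K]_n) :
  S 0 -> (forall a v w, S v -> S w -> S (a *: v + w)) ->
  S u \/ exists2 c : 'cV[K]_n, (forall w, S w -> w *m c = 0) & u *m c != 0.
Proof.
move=> S0 Slin.
pose P k := `[< exists A : 'M[K]_n, (forall v : 'rV_n, (v <= A)%MS -> S v) /\
  \rank A = k >].
have P0 : exists k, P k.
  exists 0%N; apply/asboolP; exists 0; split; last exact: mxrank0.
  by move=> v; rewrite submx0 => /eqP ->.
have Pn k : P k -> (k <= n)%N by move=> /asboolP[A [_ <-]]; exact: rank_leq_row.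
have [k /asboolP[A [AS rA]] kmax] := ex_maxnP P0 Pn.
have SA w : S w -> (w <= A)%MS.
  move=> Sw; have : P (\rank (A + w)%MS).
    apply/asboolP; exists (A + w)%MS; split=> // v /sub_addsmxP[[a b] /= ->].
    have [c ->] : exists c, b *m w = c *: w.
      by apply/sub_rVP; exact: submxMl.
    rewrite addrC; apply: Slin => //; apply: AS; exact: submxMl.
  move=> /kmax; rewrite -rA => rAw.
  apply: submx_trans (addsmxSr A w) _.
  have := mxrank_leqif_sup (addsmxSl A w); move=> [_ <-].
  by rewrite eqn_leq mxrankS ?addsmxSl.
have [/AS|uA] := boolP (u <= A)%MS; [by left|right].
have /matrix0Pn[i [j]] : u *m cokermx A != 0.
  by apply: contra uA => /eqP/eqP; rewrite -submxE.
rewrite ord1 => uj; exists (col j (cokermx A)).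
  by move=> w /SA; rewrite submxE => /eqP w0; rewrite colE mulmxA w0 mul0mx.
apply/eqP => /(congr1 (fun M : 'M[K]_1 => M 0 0)) .
rewrite colE mulmxA -colE [LHS]mxE [RHS]mxE; exact/eqP.
Qed.

End RowSpan.

Section CosetReps.
Variables (R : realType) (F : nonarchLocalFieldType R).
Local Notation G := (GL2 F).
Implicit Types (g h x k : G).

Definition coset_reps (A O : set G) (r : seq G) :=
  [/\ uniq r, (forall x, x \in r -> A x),
    (forall k, A k -> exists2 x, x \in r & O (x^-1 * k)%g) &
    (forall x y, x \in r -> y \in r -> O (x^-1 * y)%g -> x = y)].

Lemma coset_reps_exist (A O : set G) : compact A -> open_subgroup O ->
  exists r, coset_reps A O r.
Proof.
move=> cA oO; have [[e1 OM OV] _] := oO.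
have [D DA cD] : exists2 D : seq G, (forall x, x \in D -> A x) &
    forall k, A k -> exists2 x, x \in D & O (x^-1 * k)%g.
  apply: (compact_seq_cover (f := fun x => lcoset x O) cA).
  - move=> x _; apply: (rstable_open oO); apply: rstable_lcoset; exact: oO.1.
  - by move=> x Ax; exists x => //; rewrite /lcoset/= mulVg.
have [r [ur rD Dr rr]] : exists r, [/\ uniq r, {subset r <= D},
    (forall y, y \in D -> exists2 x, x \in r & O (x^-1 * y)%g) &
    (forall x y, x \in r -> y \in r -> O (x^-1 * y)%g -> x = y)].
  elim: D {DA cD} => [|a D [r [ur rD Dr rr]]]; first by exists [::].
  have [[x xr Ox]|nx] := pselect (exists2 x, x \in r & O (x^-1 * a)%g).
    exists r; split=> // [y /rD yD|y]; first by rewrite inE yD orbT.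
    by rewrite inE => /predU1P[->|/Dr//]; exists x.
  exists (a :: r); split.
  - rewrite /= ur andbT; apply/negP => ar; apply: nx.
    by exists a => //; rewrite mulVg.
  - move=> y; rewrite !inE => /predU1P[->|/rD ->]; rewrite ?eqxx ?orbT//.
  - move=> y; rewrite inE => /predU1P[->|/Dr[x xr Ox]].
      by exists a; rewrite ?inE ?eqxx ?mulVg.
    by exists x; rewrite // inE xr orbT.
  - move=> x y; rewrite !inE => /predU1P[->|xr] /predU1P[->//|yr] Oxy.
    + case: nx; exists y => //; have := OV _ Oxy; by rewrite invgM invgK.
    + by case: nx; exists x.
    + exact: rr.
exists r; split=> // [x /rD /DA//|k /cD[y /Dr[x xr Oxy] Oyk]].
exists x => //; have -> : (x^-1 * k = (x^-1 * y) * (y^-1 * k))%g.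
  by rewrite !mulgA mulgK.
exact: OM.
Qed.

Lemma coset_reps_neq0 A O r : is_subgroup A -> coset_reps A O r -> (0 < size r)%N.
Proof. by move=> [A1 _ _] [_ _ /(_ _ A1) [x] + _ _]; case: r. Qed.

(** Left multiplication by an element of A permutes the cosets. *)
Lemma coset_reps_sum A O r (V : zmodType) (f : G -> V) h : is_subgroup A ->
  is_subgroup O -> coset_reps A O r ->
  (forall k o, A k -> O o -> f (k * o)%g = f k) -> A h ->
  \sum_(x <- r) f (h * x)%g = \sum_(x <- r) f x.
Proof.
move=> [A1 AM AV] [e1 OM OV] [ur rA Ar rr] fO Ah.
have /choice[phi phiP] x : exists y, x \in r -> y \in r /\ O (y^-1 * (h * x))%g.
  have [xr|] := boolP (x \in r); last by exists x.
  by have [y yr Oy] := Ar _ (AM _ _ Ah (rA _ xr)); exists y.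
have inj : {in r &, injective phi}.
  move=> x y xr yr xy; have [_ Ox] := phiP _ xr; have [_ Oy] := phiP _ yr.
  apply: rr => //; rewrite xy in Ox.
  have := OM _ _ (OV _ Ox) Oy.
  by rewrite !invgM !invgK !mulgA mulgK mulgVK.
have up : uniq (map phi r) by rewrite map_inj_in_uniq.
have sub : {subset map phi r <= r}.
  by move=> _ /mapP[x /phiP[yr _] ->].
have pr : perm_eq (map phi r) r.
  apply: uniq_perm => //; have [] := uniq_min_size up sub; last by [].
  by rewrite size_map.
rewrite -[RHS](perm_big _ pr)/= big_map; apply: eq_big_seq => x xr.
have [yr Oy] := phiP _ xr; rewrite -(fO _ _ (rA _ yr) Oy).
by rewrite mulVKg.
Qed.

End CosetReps.

Section Representation.
Variables (R : realType) (F : nonarchLocalFieldType R).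
Local Notation G := (GL2 F).
Local Notation C := R[i].
Variables (V : lmodType C) (pi : representation F V).
Implicit Types (g h x k : G) (v w : V) (lam : {scalar V}).

(** The form in which irreducibility is used throughout. *)
Lemma stable_subspace_full (W : set V) v : irreducible pi ->
  linear_subspace W -> (forall g w, W w -> W (pi g w)) -> W v -> v != 0 ->
  forall w, W w.
Proof.
move=> [_ irr] lW sW Wv v0 w; case: (irr W lW sW) => WE; last by rewrite WE.
by move: Wv; rewrite WE => /eqP; rewrite (negPf v0).
Qed.

Lemma subgroup_open (P : set G) (e : R) : 0 < e -> is_subgroup P ->
  ball1 e `<=` P -> open P.
Proof.
move=> e0 PP eP; apply: (@rstable_open _ _ P).
  by split=> //; apply: filterS eP _; exact: ball1_nbhs1.
by case: PP => _ PM _ g k; exact: PM.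
Qed.

Lemma fix_form_subgroup (f : V -> C) :
  is_subgroup [set g | forall v, f (pi g v) = f v].
Proof.
split=> [v|g h fg fh v|g fg v]; first by rewrite rep1.
  by rewrite repM fg fh.
by rewrite -fg -repM mulgV rep1.
Qed.

Lemma fix_vector_subgroup v : is_subgroup [set g | pi g v = v].
Proof.
split=> [|g h /= gv hv|g /= gv]; first exact: rep1.
  by rewrite repM hv gv.
by rewrite -{1}gv -repM mulVg rep1.
Qed.

Lemma fix_vector_open_subgroup v : smooth pi -> open_subgroup [set g | pi g v = v].
Proof.
move=> sm; split; first exact: fix_vector_subgroup.
by apply: open_nbhs_nbhs; split; [exact: sm|exact: rep1].
Qed.

Lemma fix_form_open_subgroup lam : smooth_dual pi lam ->
  open_subgroup [set g | forall v, lam (pi g v) = lam v].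
Proof.
move=> sm; split; first exact: fix_form_subgroup.
by apply: open_nbhs_nbhs; split=> // v; rewrite rep1.
Qed.

(** By [etorus_correction] the number lam (pi x v) does not change when x is
    multiplied on the left by an element close to 1, however large x is. *)
Lemma Hom_etorus_smooth (n t : F) lam :
  (forall u v : F, tnorm n t u v = 0 -> u = 0 /\ v = 0) ->
  smooth pi -> irreducible pi ->
  Hom_to_trivial pi (etorus n t) lam -> smooth_dual pi lam.
Proof.
move=> aniso sm irr lamH; have [[v0 v00] _] := irr.
have [_ /nbhs1_ball1[e e01 eS]] := fix_vector_open_subgroup v0 sm.
have [d d0 dP] := etorus_correction aniso e01.
(* One radius d works for v0 and all its translates, hence for all vectors. *)
pose W := [set w | forall g x, ball1 d g -> lam (pi g (pi x w)) = lam (pi x w)].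
have Wall : forall w, W w.
  apply: (stable_subspace_full irr _ _ _ v00).
  - split=> [g x _|a u v Wu Wv g x gd]; first by rewrite !linear0.
    by rewrite !linearP/= Wu// Wv.
  - by move=> y w Ww g x gd; rewrite -[pi x _]repM; exact: Ww.
  move=> g x gd; have [h Hh hP] := dP g gd x.
  rewrite -(lamH h _ Hh) -2!repM.
  have -> : (h * g * x = x * (x^-1 * (h * g) * x))%g.
    by rewrite !mulgA mulgV mul1g.
  by rewrite repM (eS _ hP).
apply: (subgroup_open d0); first exact: fix_form_subgroup.
by move=> g gd v; have := Wall v g 1%g gd; rewrite rep1.
Qed.

(** The vectors that are killed by all translates of lam form a stable
    subspace. *)
Lemma zero_coef_vector lam v : irreducible pi -> (exists w, lam w != 0) ->
  (forall g, lam (pi g v) = 0) -> v = 0.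
Proof.
move=> irr [w lw] lv; apply/eqP; apply: contrapT => /negP v0.
pose W := [set u | forall g, lam (pi g u) = 0].
have : W w; last by move=> /(_ 1%g); rewrite rep1 => /eqP; rewrite (negPf lw).
apply: (stable_subspace_full irr _ _ _ v0) => //.
  split=> [g|a x y Wx Wy g]; first by rewrite !linear0.
  by rewrite !linearP/= Wx Wy mulr0 addr0.
by move=> g u Wu k; rewrite -repM; exact: Wu.
Qed.

(** A stand-in for Schur's lemma: all coefficients of pi z v - v vanish. *)
Lemma center_trivial (H : set G) : irreducible pi ->
  @group_center G `<=` H -> distinguished pi H ->
  forall z v, group_center z -> pi z v = v.
Proof.
move=> irr ZH [lam lamH lam0] z v zC; apply/eqP; rewrite -subr_eq0; apply/eqP.
apply: (zero_coef_vector irr lam0) => g.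
by rewrite !linearB/= -repM -zC repM (lamH z _ (ZH _ zC)) subrr.
Qed.

(** The smooth dual of an irreducible admissible representation is generated
    by any nonzero element: for a small compact open K, the forms that are
    combinations of translates of lam0 separate the finite-dimensional space
    of K-fixed vectors, and a K-invariant form is determined there. *)
Lemma smooth_dual_span (lam0 lam : {scalar V}) : admissible pi ->
  irreducible pi -> (exists v, lam0 v != 0) -> smooth_dual pi lam0 ->
  smooth_dual pi lam ->
  exists s : seq (C * G), forall v, lam v = \sum_(q <- s) q.1 * lam0 (pi q.2 v).
Proof.
move=> [sm adm] irr lam00 sm0 sml.
pose w (s : seq (C * G)) v := \sum_(q <- s) q.1 * lam0 (pi q.2 v).
have w_lin s a u v : w s (a *: u + v) = a * w s u + w s v.
  rewrite /w mulr_sumr -big_split/=; apply: eq_bigr => q _.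
  by rewrite !linearP/= mulrDr mulrCA.
have [_ /nbhs1_ball1[e /andP[e0 e1] eK]] := fix_form_open_subgroup sml.
pose K1 : set G := ball1 e.
have sK : is_subgroup K1 by apply: ball1_subgroup; rewrite ltW.
have oK : open K1 by exact: subgroup_open e0 sK _.
have cK : compact K1.
  apply: (GL2_closed_compact (ltr01 : 0 < (1 : R)) _ (ball1_compact_part e1)).
  apply: (@rstable_open _ _ K1); first by split=> //; exact: ball1_nbhs1.
  by apply: rstableC => //; case: sK => _ KM _ g k; exact: KM.
have [n [b [bK bspan]]] := adm _ sK oK cK.
pose row f : 'rV[C]_n := \row_i f (b i).
pose S := [set r | exists s, r = row (w s)].
have S0 : S 0 by exists [::]; apply/rowP => i; rewrite !mxE /w big_nil.
have Slin (a : C) (x y : 'rV[C]_n) : S x -> S y -> S (a *: x + y).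
  move=> [s ->] [s' ->]; exists ([seq (a * q.1, q.2) | q <- s] ++ s').
  apply/rowP => i; rewrite !mxE /w big_cat/= big_map mulr_sumr.
  by congr (_ + _); apply: eq_bigr => q _; rewrite mulrA.
have [[s lamE]|[c Sc lamc]] := row_span_dichotomy (row lam) S0 Slin; last first.
  pose u := \sum_i c i 0 *: b i.
  have rowE (f : V -> C) : (forall a (x y : V), f (a *: x + y) = a * f x + f y) ->
      (row f *m c) 0 0 = f u.
    move=> fl; have f0 : f 0 = 0.
      have /eqP := fl 1 0 0; rewrite scaler0 addr0 mul1r.
      by rewrite -{1}[f 0]addr0 (inj_eq (addrI _)) eq_sym => /eqP.
    rewrite mxE /u (big_morph f (id1 := 0) (op1 := +%R)) => [|x y|]; last 2 first.
    - by have := fl 1 x y; rewrite scale1r mul1r.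
    - exact: f0.
    apply: eq_bigr => i _; rewrite mxE mulrC.
    by have := fl (c i 0) (b i) 0; rewrite addr0 f0 addr0.
  have u0 : u = 0.
    apply: (zero_coef_vector irr lam00) => g.
    have := Sc _ (ex_intro _ [:: (1, g)] erefl).
    move=> /(congr1 (fun M : 'M[C]_1 => M 0 0)); rewrite rowE//.
    by rewrite /w big_seq1 mul1r mxE.
  case/eqP: lamc; apply/rowP => i; rewrite ord1 rowE ?u0 ?linear0 ?mxE//.
  by move=> a x y; rewrite linearP.
have lamb u : invariants pi K1 u -> lam u = w s u.
  move=> /bspan[a ->]; rewrite linear_sum/=.
  have ws0 : w s 0 = 0 by rewrite /w big1// => q _; rewrite !linear0 mulr0.
  rewrite (big_morph (w s) (id1 := 0) (op1 := +%R)) => [|x y|//]; last first.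
    by have := w_lin s 1 x y; rewrite scale1r mul1r.
  apply: eq_bigr => i _; rewrite linearZ/=.
  have := w_lin s (a i) (b i) 0; rewrite addr0 ws0 addr0 => ->; congr (_ * _).
  by have := congr1 (fun r : 'rV[C]_n => r 0 i) lamE; rewrite !mxE.
(* The form w s agrees with lam on K1-fixed vectors only; averaging it over K1
   yields a combination w' that agrees with lam everywhere.  All averages are
   finite sums, taken over representatives modulo a stabilizer, and are left
   unnormalized. *)
pose Stab : set G := [set g | forall v, w s (pi g v) = w s v].
have oStab : open_subgroup Stab.
  split; first exact: fix_form_subgroup.
  have : nbhs (1%g : G) [set g | forall q, q \in s ->
      forall v, lam0 (pi q.2 (pi g v)) = lam0 (pi q.2 v)].
    elim: s {lamE lamb Stab} => [|q s IH].
      by apply: filterS (@ball1_nbhs1 R F 1 ltr01) => g _ q; rewrite in_nil.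
    have nq : nbhs (1%g : G) [set g | forall v, lam0 (pi (q.2 * g * q.2^-1)%g v) = lam0 v].
      have : nbhs (q.2 * 1 * q.2^-1)%g [set g : G | forall v, lam0 (pi g v) = lam0 v].
        by rewrite mulg1 mulgV; case: (fix_form_open_subgroup sm0).
      by move=> /nbhs_mulr /nbhs_mull.
    apply: filterS (filterI nq IH) => g [gq gs] q'; rewrite inE => /predU1P[->|/gs//] v.
    by have := gq (pi q.2 v); rewrite -!repM mulgVK.
  apply: filterS => g gs v; rewrite /w big_seq [RHS]big_seq.
  by apply: eq_bigr => q qs; rewrite gs.
have [r rP] := coset_reps_exist cK oStab.
pose w' v := \sum_(k <- r) w s (pi (k^-1)%g v).
have w'inv k v : K1 k -> w' (pi k v) = w' v.
  move=> Kk; have KV : K1 (k^-1)%g by case: sK => _ _; apply.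
  rewrite -[RHS](coset_reps_sum (f := fun k => w s (pi (k^-1)%g v)) sK oStab.1 rP _ KV).
    by apply: eq_bigr => x _; rewrite invgM invgK repM.
  move=> x o _ So; rewrite invgM repM.
  by case: oStab => -[_ _ SV] _; rewrite (SV _ So).
have key v : (size r)%:R * lam v = w' v.
  have [r1 r1P] := coset_reps_exist cK (fix_vector_open_subgroup v sm).
  pose u := \sum_(k <- r1) pi k v.
  have uK : invariants pi K1 u.
    move=> k Kk; rewrite /u linear_sum/=.
    rewrite -[RHS](coset_reps_sum (f := fun k => pi k v) sK (fix_vector_subgroup v) r1P _ Kk).
      by apply: eq_bigr => x _; rewrite repM.
    by move=> x o _ /= ov; rewrite repM ov.
  have r1K x : x \in r1 -> K1 x by case: r1P => _ + _ _; apply.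
  have lu : lam u = (size r1)%:R * lam v.
    rewrite /u linear_sum/= big_seq.
    rewrite (eq_bigr (fun=> lam v)) => [|x /r1K xK]; last exact: (eK _ xK).
    by rewrite -big_seq big_const_seq count_predT iter_addr_0 mulr_natl.
  have w'u : w' u = (size r1)%:R * w' v.
    have w'D (x y : V) : w' (x + y) = w' x + w' y.
      rewrite /w' -big_split; apply: eq_bigr => k _ /=.
      by have := w_lin s 1 (pi k^-1%g x) (pi k^-1%g y); rewrite scale1r mul1r linearD.
    have w'0 : w' 0 = 0.
      by rewrite /w' big1// => k _; rewrite linear0 /w big1// => q _; rewrite !linear0 mulr0.
    rewrite /u (big_morph w' w'D w'0) big_seq.
    rewrite (eq_bigr (fun=> w' v)) => [|x /r1K xK]; last exact: w'inv.
    by rewrite -big_seq big_const_seq count_predT iter_addr_0 mulr_natl.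
  have w'u2 : w' u = (size r)%:R * lam u.
    rewrite (lamb u uK) /w' big_seq.
    rewrite (eq_bigr (fun=> w s u)) => [|x xr].
      by rewrite -big_seq big_const_seq count_predT iter_addr_0 mulr_natl.
    have xK : K1 (x^-1)%g by case: sK => _ _; apply; case: rP => _ + _ _; apply.
    by rewrite (uK _ xK).
  have r10 : (size r1)%:R != 0 :> C.
    by rewrite pnatr_eq0 -lt0n (coset_reps_neq0 sK r1P).
  by apply: (mulfI r10); rewrite -w'u w'u2 lu mulrCA.
have r0 : (size r)%:R != 0 :> C by rewrite pnatr_eq0 -lt0n (coset_reps_neq0 sK rP).
exists [seq (q.1 / (size r)%:R, (q.2 * k^-1)%g) | k <- r, q <- s] => v.
apply: (mulfI r0); rewrite key /w' mulr_sumr big_allpairs_dep/=.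
apply: eq_bigr => k _; apply: eq_bigr => q _ /=.
by rewrite repM mulrA [_ * (q.1 / _)]mulrC divfK.
Qed.

End Representation.

(** * Distinguished representations *)
Section Distinguished.
Variables (R : realType) (F : nonarchLocalFieldType R) (n t : F).
Local Notation G := (GL2 F).
Local Notation C := R[i].
Local Notation Z := (@group_center G).
Local Notation H := (etorus n t).
Hypothesis anisotropic : forall u v : F, tnorm n t u v = 0 -> u = 0 /\ v = 0.
Variables (V : lmodType C) (pi : representation F V).
Hypotheses (pi_adm : admissible pi) (pi_irr : irreducible pi).
Hypothesis pi_dist : distinguished pi H.
Implicit Types (g : G) (lam : {scalar V}) (v : V).

Lemma ZH_etorus : ZH H = H.
Proof.
have [H1 HM _] := etorus_subgroup n t.
apply/seteqP; split=> [_ [z zC [h Hh <-]]|h Hh].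
  by apply: HM => //; exact: center_etorus.
exists 1%g; first by case: (@center_subgroup R F).
by exists h; rewrite ?mul1g.
Qed.

Lemma ZH_subgroup : is_subgroup (ZH H).
Proof. by rewrite ZH_etorus; exact: etorus_subgroup. Qed.

Lemma center_ZH : Z `<=` ZH H.
Proof. by rewrite ZH_etorus; exact: center_etorus. Qed.

Lemma Hom_smooth lam : Hom_to_trivial pi H lam -> smooth_dual pi lam.
Proof. by case: pi_adm => sm _; exact: Hom_etorus_smooth. Qed.

Lemma coef_invariant v : exists2 Q, good_subgroup Z Q &
  forall lam g q, Q q -> matrix_coef pi lam v (g * q)%g = matrix_coef pi lam v g.
Proof.
have [sm _] := pi_adm.
have [_ /nbhs1_ball1[e e01 eS]] := fix_vector_open_subgroup v sm.
have [|Q gQ Qzu] := good_subgroup_exists (@center_subgroup R F) e01.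
  by exists 1 => z; exact: bdd_center.
exists Q => // lam g q /Qzu[z [u [zC /eS ue ->]]].
rewrite /matrix_coef repM (repM _ z) ue.
by rewrite (center_trivial pi_irr (@center_etorus _ n t) pi_dist _ zC).
Qed.

(** Right translation of a relative coefficient acts on lam; P is built from H
    and the stabilizer of lam, which is open because lam is smooth. *)
Lemma rel_coef_invariant lam : Hom_to_trivial pi H lam ->
  exists2 P, good_subgroup (ZH H) P & forall v g p, P p ->
    rel_matrix_coef pi lam v (g * p)%g = rel_matrix_coef pi lam v g.
Proof.
move=> lamH.
have [_ /nbhs1_ball1[e e01 eS]] := fix_form_open_subgroup (Hom_smooth lamH).
have [|P gP Phu] := good_subgroup_exists ZH_subgroup e01.
  by rewrite ZH_etorus; exact: etorus_bdd.
exists P => // v g p Pp; have : P (p^-1)%g.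
  by case: gP => -[[_ _ PV] _] _ _; exact: PV.
rewrite /rel_matrix_coef invgM => /Phu[h [u [Hh /eS ue ->]]].
rewrite ZH_etorus in Hh.
by rewrite -mulgA repM (lamH h _ Hh) repM ue.
Qed.

Lemma rel_coefE lam v g : rel_matrix_coef pi lam v g = matrix_coef pi lam v (g^-1)%g.
Proof. by []. Qed.

Lemma compact_coef_transfer lam v : Hom_to_trivial pi H lam ->
  compact_mod (ZH H) (rel_matrix_coef pi lam v) <->
  compact_mod Z (matrix_coef pi lam v).
Proof.
move=> lamH; have [P gP Pinv] := rel_coef_invariant lamH.
have [Q gQ Qinv] := coef_invariant v.
have ZZ : Z `<=` Z by [].
rewrite (compact_modP ZH_subgroup center_ZH gP (Pinv v)).
rewrite (compact_modP (@center_subgroup R F) ZZ gQ (Qinv lam)).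
split=> -[D bD]; exists D => g mg; rewrite -[g]invgK; apply/bddV/bD => //.
by rewrite rel_coefE invgK.
Qed.

Section Integrability.
Variables (mu : {measure set (coset_borel Z) -> \bar R}).
Variables (nu : {measure set (coset_borel (ZH H)) -> \bar R}) (p : R).
Hypotheses (mu_inv : invariant_measure mu) (nu_inv : invariant_measure nu).
Hypothesis p0 : 0 < p.

Lemma Lp_coef_transfer lam v : Hom_to_trivial pi H lam ->
  Lp_mod nu p (rel_matrix_coef pi lam v) <-> Lp_mod mu p (matrix_coef pi lam v).
Proof.
move=> lamH; have [P gP Pinv] := rel_coef_invariant lamH.
have gPZ := good_subgroup_center center_ZH gP.
have ZZ : Z `<=` Z by [].
have sZ := @center_subgroup R F.
have E : matrix_coef pi lam v = fun g => rel_matrix_coef pi lam v (g^-1)%g.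
  by apply/funext => g; rewrite rel_coefE invgK.
rewrite E -(Lp_mod_inv mu_inv gPZ (Pinv v) p0); split.
  exact: (Lp_mod_change (Pinv v) p0 ZH_subgroup sZ center_ZH ZZ nu_inv mu_inv gP gPZ).
exact: (Lp_mod_change (Pinv v) p0 sZ ZH_subgroup ZZ center_ZH mu_inv nu_inv gPZ gP).
Qed.

Lemma Lp_coef_smooth_dual lam0 lam v : (exists w, lam0 w != 0) ->
  smooth_dual pi lam0 -> smooth_dual pi lam ->
  Lp_mod mu p (matrix_coef pi lam0 v) -> Lp_mod mu p (matrix_coef pi lam v).
Proof.
move=> lam00 sm0 sml L0; have [Q gQ Qinv] := coef_invariant v.
have [s lamE] := smooth_dual_span pi_adm pi_irr lam00 sm0 sml.
have -> : matrix_coef pi lam v =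
    fun g => \sum_(q <- s) q.1 * matrix_coef pi lam0 v (q.2 * g)%g.
  apply/funext => g; rewrite /matrix_coef lamE; apply: eq_bigr => q _.
  by rewrite repM.
have ZZ : Z `<=` Z by [].
exact: (Lp_mod_combination (@center_subgroup R F) ZZ mu_inv gQ p0 s (Qinv lam0) L0).
Qed.

Lemma rel_Lp_iff :
  (forall v lam, Hom_to_trivial pi H lam -> Lp_mod nu p (rel_matrix_coef pi lam v)) <->
  (forall lam v, smooth_dual pi lam -> Lp_mod mu p (matrix_coef pi lam v)).
Proof.
split=> [rel lam v sml|ord v lam lamH]; last first.
  by apply/Lp_coef_transfer => //; apply: ord; exact: Hom_smooth.
have [lam0 lam0H lam00] := pi_dist.
apply: (Lp_coef_smooth_dual lam00 (Hom_smooth lam0H) sml).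
by apply/Lp_coef_transfer => //; exact: rel.
Qed.

End Integrability.

Lemma rel_cuspidal_iff : rel_cuspidal pi H <-> supercuspidal pi.
Proof.
have ZZ : Z `<=` Z by [].
have sZ := @center_subgroup R F.
split=> [rel lam v sml|sc v lam lamH]; last first.
  by apply/compact_coef_transfer => //; apply: sc; exact: Hom_smooth.
have [lam0 lam0H lam00] := pi_dist.
have [s lamE] := smooth_dual_span pi_adm pi_irr lam00 (Hom_smooth lam0H) sml.
have [Q gQ Qinv] := coef_invariant v.
have /(compact_coef_transfer v lam0H) := rel v lam0 lam0H.
move=> /(compact_modP sZ ZZ gQ (Qinv lam0))[D bD].
apply/(compact_modP sZ ZZ gQ (Qinv lam)).
have [cst cstP] := choice (@bdd_exists R F).
exists (\sum_(q <- s) `|cst (q.2^-1)%g * D|) => g.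
rewrite /matrix_coef lamE => mg.
have [q qs qg] : exists2 q, q \in s & lam0 (pi q.2 (pi g v)) != 0.
  apply: contrapT => nq; case/eqP: mg; rewrite big_seq big1// => q qs.
  have [->|qg] := eqVneq (lam0 (pi q.2 (pi g v))) 0; first by rewrite mulr0.
  by case: nq; exists q.
rewrite -repM in qg; rewrite -[g](mulKg q.2).
apply: (bdd_le _ (bddM (cstP _) (bD _ qg))).
rewrite (big_rem q)//= (le_trans (ler_norm _))// lerDl.
by apply: sumr_ge0 => i _; exact: normr_ge0.
Qed.

End Distinguished.

Theorem theorem1p3 (R : realType) (F : nonarchLocalFieldType R)
    (p : nat) (p_res : residue_char F p) (p_odd : odd p)
    (K : closedFieldType) (iota : {rmorphism F -> K}) (T : set (GL2 K))
    (T_max : maximal_torus T) (T_F : defined_over iota T)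
    (T_nonsplit : ~ split_over iota T)
    (mu : {measure set (coset_borel (@group_center (GL2 F))) -> \bar R})
    (mu_inv : invariant_measure mu)
    (nu : {measure set (coset_borel (ZH (rational_points iota T))) -> \bar R})
    (nu_inv : invariant_measure nu)
    (V : lmodType R[i]) (pi : representation F V)
    (pi_adm : admissible pi) (pi_irr : irreducible pi)
    (pi_dist : distinguished pi (rational_points iota T)) :
  [/\ rel_cuspidal pi (rational_points iota T) <-> supercuspidal pi,
      rel_square_integrable pi nu <-> square_integrable pi mu
    & rel_tempered pi nu <-> tempered pi mu].
Proof.
have [n [t [aniso HE]]] := nonsplit_torusP T_max T_F T_nonsplit.
move: nu nu_inv pi_dist; rewrite HE => nu nu_inv pi_dist.
split; first exact: rel_cuspidal_iff.
- have iff2 := rel_Lp_iff aniso pi_adm pi_irr pi_dist mu_inv nu_inv (ltr0n R 2).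
  by split=> -[uc H]; split=> //; apply/iff2.
- have iffp e (e0 : 0 < e) := rel_Lp_iff aniso pi_adm pi_irr pi_dist mu_inv nu_inv
    (addr_gt0 (ltr0n R 2) e0).
  by split=> -[uc H]; split=> // e e0; apply/(iffp e e0)/H.
Qed.
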